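(* Let $\mathbb{P}$ be the set of all prime numbers. For every increasing computable function $F:\mathbb{N}\to\mathbb{N}$, there exist computable functions $\Lambda:\mathbb{N}\to\mathbb{N}$ and $\hat{q}:\mathbb{N}\to\mathbb{P}$ such that the following holds. For every fixed parameter $k\in\mathbb{N}$, there is a randomized reduction running in $\Lambda(k)^{O(1)}\cdot\mathrm{poly}(n)$ time which, given as input an instance $(U_1,\ldots,U_k)$ of $k$-Vector Sum where each $U_i$ is a collection of $n$ vectors in $\mathbb{F}_{\hat{q}(k)}^{O(k^2\log n)}$, outputs a graph $G$ such that: (Completeness) if there exist $\vec{u}_1\in U_1,\ldots,\vec{u}_k\in U_k$ with $\sum_{i\in[k]}\vec{u}_i=\vec{0}$, then $G$ has a clique of size exactly $\Lambda(k)$; (Soundness) if for all $\vec{u}_1\in U_1,\ldots,\vec{u}_k\in U_k$ we have $\sum_{i\in[k]}\vec{u}_i\neq\vec{0}$, then $G$ has no clique of size $\Lambda(k)^{1-\frac{1}{F(\Lambda(k))}}$; (Size) the number of vertices of $G$ is at most $\Lambda(k)\cdot\mathrm{poly}(n)$.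
   Context: The $k$-Vector Sum problem over $\mathbb{F}_q$ ($q$ prime): given $k$ sets $U_1,\ldots,U_k$ of vectors in $\mathbb{F}_q^m$, decide whether there exist $\vec{u}_1\in U_1,\ldots,\vec{u}_k\in U_k$ with $\sum_{i\in[k]}\vec{u}_i=\vec{0}$. A function $F:\mathbb{N}\to\mathbb{N}$ is increasing if $F(k+1)\ge F(k)$ for all $k$ and $\lim_{k\to\infty}F(k)=\infty$. *)

(* Defs.v *)
From mathcomp Require Import all_boot all_order all_algebra.
From mathcomp Require Import all_classical all_reals all_analysis.
Set Implicit Arguments.
Unset Strict Implicit.
Unset Printing Implicit Defensive.
Import Order.TTheory GRing.Theory Num.Theory.
Local Open Scope ring_scope.

(* Kleene's total recursive functions; minimization is restricted to regular
   functions, so that the class consists exactly of the total computable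
   functions. *)
Inductive recursive : forall k, (k.-tuple nat -> nat) -> Prop :=
| rec_zero k : @recursive k (fun=> 0%N)
| rec_succ : @recursive 1 (fun v => (thead v).+1)
| rec_proj k (i : 'I_k) : recursive (fun v => tnth v i)
| rec_comp k l (f : l.-tuple nat -> nat) (g : 'I_l -> k.-tuple nat -> nat) :
    recursive f -> (forall i, recursive (g i)) ->
    recursive (fun v => f [tuple g i v | i < l])
| rec_prim k (f : k.-tuple nat -> nat) (g : k.+2.-tuple nat -> nat)
    (h : k.+1.-tuple nat -> nat) :
    recursive f -> recursive g ->
    (forall v : k.-tuple nat, h [tuple of 0%N :: v] = f v) ->
    (forall x (v : k.-tuple nat),
      h [tuple of x.+1 :: v] = g [tuple of x :: h [tuple of x :: v] :: v]) ->
    recursive h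
| rec_min k (f : k.+1.-tuple nat -> nat) (h : k.-tuple nat -> nat) :
    recursive f ->
    (forall v, f [tuple of h v :: v] = 0%N) ->
    (forall v y, (y < h v)%N -> f [tuple of y :: v] <> 0%N) ->
    recursive h.

Definition computable (F : nat -> nat) : Prop :=
  exists2 f, @recursive 1 f & forall x, F x = f [tuple x].

Definition incr_unbounded (F : nat -> nat) : Prop :=
  (forall k, (F k <= F k.+1)%N) /\ (F k @[k --> \oo] --> \oo)%classic.

(* Probabilistic RAM: registers x and memory cells M[a] hold natural numbers.
   Every elementary instruction and every test costs one time unit.  Values at
   most double at each step (there is no multiplication and the only literals
   are 0 and 1), so time is polynomially equivalent to Turing machine time. *)
Inductive prog :=
| Lit of nat & bool              (* x := 0 or x := 1 *)
| Add of nat & nat & nat         (* x := y + z *)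
| Monus of nat & nat & nat       (* x := max(y - z, 0) *)
| Half of nat & nat              (* x := floor(y / 2) *)
| Read of nat & nat              (* x := M[y] *)
| Write of nat & nat             (* M[x] := y *)
| Flip of nat                    (* x := a fresh uniform random bit *)
| Seq of prog & prog
| If of nat & prog & prog        (* test x <> 0 *)
| While of nat & prog.           (* while x <> 0 *)

Record state := State { reg : nat -> nat; ram : nat -> nat }.

Definition upd (f : nat -> nat) (a b : nat) : nat -> nat :=
  fun i => if i == a then b else f i.

Definition set_reg (s : state) (x v : nat) : state :=
  State (upd (reg s) x v) (ram s).

(* exec p s r t s' r': started in s with coin tosses r still to be consumed,
   p halts after t time units in s', with coin tosses r' left over. *)
Inductive exec :
  prog -> state -> seq bool -> nat -> state -> seq bool -> Prop :=
| exec_lit x (b : bool) s r : exec (Lit x b) s r 1 (set_reg s x b) r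
| exec_add x y z s r :
    exec (Add x y z) s r 1 (set_reg s x (reg s y + reg s z)%N) r
| exec_monus x y z s r :
    exec (Monus x y z) s r 1 (set_reg s x (reg s y - reg s z)%N) r
| exec_half x y s r : exec (Half x y) s r 1 (set_reg s x (reg s y)./2) r
| exec_read x y s r : exec (Read x y) s r 1 (set_reg s x (ram s (reg s y))) r
| exec_write x y s r :
    exec (Write x y) s r 1 (State (reg s) (upd (ram s) (reg s x) (reg s y))) r
| exec_flip x s (b : bool) r : exec (Flip x) s (b :: r) 1 (set_reg s x b) r
| exec_seq p1 p2 s1 r1 t1 s2 r2 t2 s3 r3 :
    exec p1 s1 r1 t1 s2 r2 -> exec p2 s2 r2 t2 s3 r3 ->
    exec (Seq p1 p2) s1 r1 (t1 + t2)%N s3 r3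
| exec_if x p1 p2 s r t s' r' :
    exec (if reg s x == 0%N then p2 else p1) s r t s' r' ->
    exec (If x p1 p2) s r t.+1 s' r'
| exec_while0 x p s r : reg s x = 0%N -> exec (While x p) s r 1 s r
| exec_whileS x p s1 r1 t1 s2 r2 t2 s3 r3 :
    reg s1 x <> 0%N ->
    exec p s1 r1 t1 s2 r2 -> exec (While x p) s2 r2 t2 s3 r3 ->
    exec (While x p) s1 r1 (t1 + t2)%N.+1 s3 r3.

Definition init_state (inp : seq nat) : state := State (fun=> 0%N) (nth 0%N inp).

Record graph := Graph {
  nverts : nat;
  adj : rel 'I_nverts;
  adj_sym : symmetric adj;
  adj_irr : irreflexive adj }.

Definition clique (G : graph) (S : {set 'I_(nverts G)}) : Prop :=
  {in S &, forall u v, u != v -> adj u v}.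

(* Number of vertices in M[0], then the 0/1 adjacency matrix row by row. *)
Definition encodes_graph (s : state) (G : graph) : Prop :=
  ram s 0 = nverts G /\
  forall u v : 'I_(nverts G), ram s (1 + u * nverts G + v)%N = adj u v.

Definition outputs (p : prog) (inp : seq nat) (T : nat) (r : T.-tuple bool)
    (G : graph) : Prop :=
  exists t s r', [/\ exec p (init_state inp) r t s r', (t <= T)%N
                   & encodes_graph s G].

(* Within T time units at most T coins are tossed, so T uniform independent
   bits are all the randomness a computation of length T can use. *)
Definition coin_prob (T : nat) (E : T.-tuple bool -> Prop) : rat :=
  #|[pred r : T.-tuple bool | `[< E r >]]|%:R / (2 ^ T)%N%:R.

Definition has_vector_sum (q k n m : nat)
    (U : 'I_k -> n.-tuple 'rV['F_q]_m) : Prop :=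
  exists u : 'I_k -> 'rV['F_q]_m, (forall i, u i \in U i) /\ \sum_i u i = 0.

(* n, m, then the coordinates (representatives in [0, q)) of all vectors. *)
Definition vector_sum_input (q k n m : nat)
    (U : 'I_k -> n.-tuple 'rV['F_q]_m) : seq nat :=
  n :: m :: flatten [seq [seq nat_of_ord (u ord0 l)
                         | u : 'rV['F_q]_m <- U i, l : 'I_m <- enum 'I_m]
                    | i <- enum 'I_k].

(* Main.v *)
Require Import Defs.
From mathcomp Require Import all_boot all_order all_algebra zify ring lra.
From mathcomp Require Import all_classical all_reals all_analysis.
Import Order.TTheory GRing.Theory Num.Theory.
Set Implicit Arguments.
Unset Strict Implicit.
Unset Printing Implicit Defensive.

(** Fix [k], a large prime [q] and [Lambda = q^(k+1)], and think of the vertex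
groups as indexed by [(alpha, gamma)] in [[q]^k * F_q].  The honest label of a
group is a pair: the integer [X = sum_i alpha_i j_i], where [j_i] is the index
of [u_i] in [U_i], and the [k] symbols at position [gamma] of the Reed-Solomon
encodings of [u_1, .., u_k], which must add up to zero.  Cutting a vector into
[s ~ k^3 log q] blocks makes the number of labels polynomial in [n] with an
exponent independent of [k].  Two groups with the same [alpha] must agree on
[X]; two groups whose [alpha]'s differ in coordinate [i] only must be explained
by a common vector of [U_i], which the difference of the two [X]'s determines;
all other pairs are unconstrained.

In a clique, the groups that are alone on their line in some direction [i]
number at most [k q^k].  If the clique contains [s] of the remaining groups
over one [alpha], then their neighbours determine [u_1, .., u_k], whose sum is
encoded by a word with [s] zeros, so it vanishes.  Hence a no-instance has
cliques smaller than [(k + s) q^k <= Lambda^(1 - 1/F(Lambda))] once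
[F (Lambda) >= 2 (k + 1)] and [q >= (k + s)^2].

The reduction is deterministic.  Inputs with [n] below a bound depending on [k]
are handled by a hard-wired decision tree, so that for the others every factor
depending on [k] only is at most [n]. *)

(** * Recursive functions *)

(** Arguments are read with [nth] rather than [tnth], so that on an explicit tuple they reduce by
    computation. *)
Definition recursive1 (f : nat -> nat) :=
  @recursive 1 (fun v => f (nth 0 v 0)).
Definition recursive2 (f : nat -> nat -> nat) :=
  @recursive 2 (fun v => f (nth 0 v 0) (nth 0 v 1)).
Definition recursive3 (f : nat -> nat -> nat -> nat) :=
  @recursive 3 (fun v => f (nth 0 v 0) (nth 0 v 1) (nth 0 v 2)).

Lemma recursive_ext k (f g : k.-tuple nat -> nat) :
  f =1 g -> recursive f -> recursive g.
Proof. by move=> /funext ->. Qed.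

Lemma recursive_nth k i : i < k -> @recursive k (fun v => nth 0 v i).
Proof.
move=> ik; apply: recursive_ext (rec_proj (Ordinal ik)) => v.
by rewrite (tnth_nth 0).
Qed.

Lemma recursive_const k c : @recursive k (fun=> c).
Proof.
elim: c => [|c IHc]; first exact: rec_zero.
apply: recursive_ext (rec_comp rec_succ (fun _ : 'I_1 => IHc)) => v.
by rewrite /thead tnth_mktuple.
Qed.

Section Composition.
Variables (k : nat) (f1 f2 : k.-tuple nat -> nat).
Hypotheses (h1 : recursive f1) (h2 : recursive f2).

Lemma recursive_comp1 F : recursive1 F -> recursive (fun v => F (f1 v)).
Proof.
move=> hF; apply: recursive_ext (rec_comp hF (fun _ : 'I_1 => h1)) => v.
by rewrite -(tnth_nth 0 _ ord0) tnth_mktuple.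
Qed.

Lemma recursive_comp2 F : recursive2 F -> recursive (fun v => F (f1 v) (f2 v)).
Proof.
move=> hF; pose g (i : 'I_2) := if val i == 0 then f1 else f2.
have hg i : recursive (g i) by rewrite /g; case: ifP.
apply: recursive_ext (rec_comp hF hg) => v.
by rewrite -(tnth_nth 0 _ ord0) -(tnth_nth 0 _ (Ordinal (isT : 1 < 2))) !tnth_mktuple.
Qed.

End Composition.

(** This is [rec_prim] with one parameter. The recursion variable comes first, so functions that
    recurse on their second argument go through [recursive2_swap]. *)
Lemma recursive2_iteri f g : recursive1 f -> recursive3 g ->
  recursive2 (fun x y => iteri x (fun i a => g i a y) (f y)).
Proof.
move=> hf hg; apply: (rec_prim hf hg) => [v|x v].
  by rewrite /=.
by rewrite /=.
Qed.

Lemma recursive1_succ : recursive1 S.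
Proof. by apply: recursive_ext rec_succ => v; case/tupleP: v => x v; rewrite theadE. Qed.

Lemma recursive2_swap f : recursive2 f -> recursive2 (fun x y => f y x).
Proof. by move=> hf; apply: recursive_comp2 hf; apply: recursive_nth. Qed.

Lemma recursive2_add : recursive2 addn.
Proof.
apply: recursive_ext (@recursive2_iteri id (fun i a y => a.+1) _ _) => [v||].
- by elim: (nth 0 v 0) => //= x ->.
- exact: recursive_nth.
- by apply: (recursive_comp1 _ recursive1_succ); apply: recursive_nth.
Qed.

Lemma recursive1_pred : recursive1 predn.
Proof.
(* Primitive recursion is available with a parameter only: a dummy second argument is added and
   removed at the end by composing on the diagonal. *)
have h : recursive2 (fun x _ => x.-1).
  apply: recursive_ext (@recursive2_iteri (fun=> 0) (fun i a y => i) _ _) => [v||].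
  - by case: (nth 0 v 0).
  - exact: recursive_const.
  - exact: recursive_nth.
have h0 : @recursive 1 (fun v => nth 0 v 0) by apply: recursive_nth.
exact: (recursive_comp2 h0 h0 h).
Qed.

Lemma recursive2_sub : recursive2 subn.
Proof.
apply: (@recursive2_swap (fun x y => y - x)).
apply: recursive_ext (@recursive2_iteri id (fun i a y => a.-1) _ _) => [v||].
- by elim: (nth 0 v 0) => [|x IHx] /=; [rewrite subn0 | rewrite IHx subnS].
- exact: recursive_nth.
- by apply: (recursive_comp1 _ recursive1_pred); apply: recursive_nth.
Qed.

Lemma recursive2_mul : recursive2 muln.
Proof.
apply: recursive_ext (@recursive2_iteri (fun=> 0) (fun i a y => y + a) _ _) => [v||].
- by elim: (nth 0 v 0) => //= x ->.
- exact: recursive_const.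
- by apply: (recursive_comp2 _ _ recursive2_add); apply: recursive_nth.
Qed.

Lemma recursive2_exp : recursive2 expn.
Proof.
apply: (@recursive2_swap (fun x y => y ^ x)).
apply: recursive_ext (@recursive2_iteri (fun=> 1) (fun i a y => y * a) _ _) => [v||].
- by elim: (nth 0 v 0) => //= x ->; rewrite expnS.
- exact: recursive_const.
- by apply: (recursive_comp2 _ _ recursive2_mul); apply: recursive_nth.
Qed.

Lemma recursive1_fact : recursive1 factorial.
Proof.
have h : recursive2 (fun x _ => x`!).
  apply: recursive_ext (@recursive2_iteri (fun=> 1) (fun i a y => i.+1 * a) _ _) => [v||].
  - by elim: (nth 0 v 0) => //= x ->; rewrite factS.
  - exact: recursive_const.
  - apply: (recursive_comp2 _ _ recursive2_mul); last exact: recursive_nth.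
    by apply: (recursive_comp1 _ recursive1_succ); apply: recursive_nth.
have h0 : @recursive 1 (fun v => nth 0 v 0) by apply: recursive_nth.
exact: (recursive_comp2 h0 h0 h).
Qed.

(* Agrees with [x %% d] only for [0 < d]. *)
Definition rec_mod (x d : nat) : nat :=
  iteri x (fun _ a => a.+1 * (1 - (1 - (d - a.+1)))) 0.

(** The factor [1 - (1 - (d - a.+1))] is 1 while [a.+1 < d] and 0 once [a.+1 = d], so the residue
    counts up and is reset at [d]. *)
Lemma rec_modE x d : 0 < d -> rec_mod x d = x %% d.
Proof.
move=> d0; elim: x => [|x IHx]; first by rewrite mod0n.
rewrite [LHS]/= -/(rec_mod x d) IHx -(addn1 x) -modnDml addn1.
have := ltn_pmod x d0; rewrite leq_eqVlt => /predU1P[->|lt].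
  by rewrite modnn subnn muln0.
by rewrite (modn_small lt); nia.
Qed.

Lemma recursive2_rec_mod : recursive2 rec_mod.
Proof.
apply: (@recursive2_iteri (fun=> 0)
  (fun _ a d => a.+1 * (1 - (1 - (d - a.+1))))); first exact: recursive_const.
have hS : @recursive 3 (fun v => (nth 0 v 1).+1).
  by apply: (recursive_comp1 _ recursive1_succ); apply: recursive_nth.
apply: (recursive_comp2 hS _ recursive2_mul).
do 2!apply: (recursive_comp2 (recursive_const _ _) _ recursive2_sub).
by apply: (recursive_comp2 _ hS recursive2_sub); apply: recursive_nth.
Qed.

(** * Computable choice of the prime *)

Section GapPrime.
Variable F : nat -> nat.
Hypotheses (F_incr : incr_unbounded F) (F_comp : computable F).

Lemma incr_unbounded_ge A : exists N, forall x, N <= x -> A <= F x.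
Proof.
have [_ /(_ [set x | A <= x]%classic) []] := F_incr; first by exists A.
by move=> N _ hN; exists N => x Nx; apply: hN.
Qed.

(** The bound on [F] lets the exponent [1 - 1/F] lose at most a factor [sqrt y] of [y ^ k.+1]; the
    bound [2 ^ (k + 44)] makes that factor exceed [k + s], where [s] is the number of blocks
    ([code_length_le]). *)
Definition gap_prime_cond (k y : nat) : bool :=
  [&& prime y, 2 * k.+1 <= F (y ^ k.+1) & 2 ^ (k + 44) <= y].

Lemma gap_prime_ex k : exists y, gap_prime_cond k y.
Proof.
have [N hN] := incr_unbounded_ge (2 * k.+1).
have [y yN y_pr] := prime_above (maxn N (2 ^ (k + 44))).
move: yN; rewrite gtn_max => /andP[Ny ky].
exists y; rewrite /gap_prime_cond y_pr (ltnW ky) andbT /=; apply: hN.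
(* Since [y <= y ^ k.+1], a prime beyond [N] has its power beyond [N] as well. *)
by rewrite (leq_trans (ltnW Ny)) // expnS leq_pmulr // expn_gt0 prime_gt0.
Qed.

Definition gap_prime (k : nat) : nat := ex_minn (gap_prime_ex k).

Lemma gap_primeP k : gap_prime_cond k (gap_prime k).
Proof. by rewrite /gap_prime; case: ex_minnP. Qed.

Lemma recursive1_F : recursive1 F.
Proof.
have [f hf fE] := F_comp; apply: recursive_ext hf => v.
rewrite fE; congr f; apply: eq_from_tnth => i.
by rewrite !(tnth_nth 0) (ord1 i).
Qed.

(** Truncated differences turn inequalities into summands that vanish. Primality is Wilson's
    criterion: [2 <= y] and [y] divides [(y-1)! + 1]. *)
Definition gap_prime_test (k y : nat) : nat :=
  (2 - y) + rec_mod (y.-1)`!.+1 y + (2 * k.+1 - F (y ^ k.+1)) +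
  (2 ^ (k + 44) - y).

Lemma gap_prime_testE k y : (gap_prime_test k y == 0) = gap_prime_cond k y.
Proof.
rewrite /gap_prime_test /gap_prime_cond.
have [y1|] := ltnP 1 y; last by case: y => [|[]].
by rewrite (rec_modE _ (ltnW y1)) Wilson // /dvdn !addn_eq0 !subn_eq0 y1 -!andbA.
Qed.

Lemma recursive2_gap_prime_test : recursive2 (fun y k => gap_prime_test k y).
Proof.
have hy : @recursive 2 (fun v => nth 0 v 0) by apply: recursive_nth.
have hk : @recursive 2 (fun v => nth 0 v 1) by apply: recursive_nth.
have hk1 : @recursive 2 (fun v => (nth 0 v 1).+1).
  exact: recursive_comp1 hk _ recursive1_succ.
have c n := @recursive_const 2 n.
apply: (recursive_comp2 _ _ recursive2_add).
  apply: (recursive_comp2 _ _ recursive2_add).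
    apply: (recursive_comp2 _ _ recursive2_add).
      exact: (recursive_comp2 (c 2) hy recursive2_sub).
    apply: (recursive_comp2 _ hy recursive2_rec_mod).
    apply: (recursive_comp1 _ recursive1_succ).
    apply: (recursive_comp1 _ recursive1_fact).
    exact: (recursive_comp1 hy recursive1_pred).
  apply: (recursive_comp2 _ _ recursive2_sub).
    exact: (recursive_comp2 (c 2) hk1 recursive2_mul).
  apply: (recursive_comp1 _ recursive1_F).
  exact: (recursive_comp2 hy hk1 recursive2_exp).
apply: (recursive_comp2 _ hy recursive2_sub).
apply: (recursive_comp2 (c 2) _ recursive2_exp).
exact: (recursive_comp2 hk (c 44) recursive2_add).
Qed.

(** The search is regular because [gap_primeP] provides a zero of the test. The candidate [y] is the
    first argument of the test, as [rec_min] requires. *)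
Lemma recursive1_gap_prime : recursive1 gap_prime.
Proof.
apply: (rec_min recursive2_gap_prime_test) => [v|v y] /=.
  by apply/eqP; rewrite gap_prime_testE gap_primeP.
rewrite /gap_prime; case: ex_minnP => z _ hz yz /eqP.
by rewrite gap_prime_testE => /hz; rewrite leqNgt yz.
Qed.

Lemma recursive1_computable f : recursive1 f -> computable f.
Proof. by move=> hf; exists (fun v => f (nth 0 v 0)). Qed.

Lemma computable_gap_prime : computable gap_prime.
Proof. exact/recursive1_computable/recursive1_gap_prime. Qed.

Lemma computable_gap_prime_exp : computable (fun k => gap_prime k ^ k.+1).
Proof.
apply: recursive1_computable; apply: (recursive_comp2 _ _ recursive2_exp).
  exact: recursive1_gap_prime.
exact: recursive1_succ.
Qed.

End GapPrime.

(** * The gap graph *)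

Section GapGraph.
Variables (q k n s h : nat) (x : nat -> nat -> nat -> nat).

(** A vertex is a number. Its base-[q] digits hold [alpha] (positions below [k]), then [gamma]
    (position [k]), then [k] blocks of [h] symbols, one block per vector; the part from position
    [offset] on is the integer [X]. The value [x i j t] stands for coordinate [t] of the vector [j]
    of [U_i]. *)
Definition dig (v d : nat) : nat := v %/ q ^ d %% q.

Definition offset : nat := k + 1 + k * h.

Definition top (v : nat) : nat := v %/ q ^ offset.

(** A vector is cut into [s] blocks of length [h]. The entries at place [t] of the blocks are the
    coefficients of a polynomial of degree below [s], evaluated at [g]; so there are [h] interleaved
    codewords. *)
Definition rs_code (g i j t : nat) : nat :=
  (\sum_(l < s) g ^ l * x i j (l * h + t)) %% q.

Definition valid (v : nat) : bool :=
  [forall t : 'I_h, q %| \sum_(i < k) dig v (k + 1 + i * h + t)].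

Definition codes (i j v : nat) : bool :=
  [forall t : 'I_h, dig v (k + 1 + i * h + t) == rs_code (dig v k) i j t].

(** The equation says that the difference of the two [X]'s is [j] times the difference of the two
    [alpha_i], with terms moved across to avoid truncated subtraction. *)
Definition joined (i v w : nat) : bool :=
  [exists j : 'I_n, [&& dig v i * j + top w == dig w i * j + top v,
                      codes i j v & codes i j w]].

Definition ndiff (v w : nat) : nat := \sum_(i < k) (dig v i != dig w i).

(** When the [alpha]'s coincide, distinct [gamma]'s are demanded, so a clique has at most one vertex
    per group. *)
Definition gap_adj (v w : nat) : bool :=
  [&& valid v, valid w &
    (1 < ndiff v w) ||
    [forall i : 'I_k, (dig v i == dig w i) || joined i v w] &&
    ((0 < ndiff v w) || (dig v k != dig w k) && (top v == top w))].

(** The last factor counts the values of [X], which is at most [k * q * n]. *)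
Definition gap_order : nat := q ^ offset * (k * q * n + 1).

Definition solution (j : 'I_k -> 'I_n) : Prop :=
  forall t, t < s * h -> q %| \sum_(i < k) x i (j i) t.

Lemma ndiffC v w : ndiff v w = ndiff w v.
Proof. by apply: eq_bigr => i _; rewrite eq_sym. Qed.

Lemma joinedC i v w : joined i v w = joined i w v.
Proof.
apply: eq_existsb => j; rewrite eq_sym; congr (_ && _); exact: andbC.
Qed.

Lemma gap_adjC v w : gap_adj v w = gap_adj w v.
Proof.
rewrite /gap_adj ndiffC andbCA [dig v k == _]eq_sym [top v == _]eq_sym.
do 4!congr (_ && _) || congr (_ || _).
by apply: eq_forallb => i; rewrite eq_sym joinedC.
Qed.

Lemma gap_adjxx v : gap_adj v v = false.
Proof.
rewrite /gap_adj; have -> : ndiff v v = 0.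
  by rewrite /ndiff big1 // => i _; rewrite eqxx.
by rewrite eqxx /= andbF !andbF.
Qed.

Hypothesis q_pr : prime q.

Let q_gt0 : 0 < q. Proof. exact: prime_gt0. Qed.

Lemma dig_lt v d : dig v d < q. Proof. by rewrite ltn_pmod. Qed.

Lemma ndiff1 v w (i : 'I_k) : dig v i != dig w i ->
  (forall j : 'I_k, j != i -> dig v j = dig w j) -> ndiff v w = 1.
Proof.
move=> di dj; rewrite /ndiff (bigD1 i) //= di big1 // => j /dj ->.
by rewrite eqxx.
Qed.

Lemma ndiff0 v w : (forall j : 'I_k, dig v j = dig w j) -> ndiff v w = 0.
Proof. by move=> dj; rewrite /ndiff big1 // => j _; rewrite dj eqxx. Qed.

Lemma natr_Fp_inj a b : a < q -> b < q ->
  (a%:R = b%:R :> 'F_q)%R -> a = b.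
Proof.
move=> aq bq /(congr1 val); rewrite /= !val_Fp_nat // !modn_small //.
Qed.

(* Reed-Solomon decoding: a polynomial of degree below [s] over [F_q] with [s]
   roots vanishes. *)
Lemma solution_of_codes (j : 'I_k -> 'I_n) (A : {set 'I_gap_order}) :
  0 < h -> s <= #|A| -> {in A &, injective (fun v : 'I_gap_order => dig v k)} ->
  (forall v, v \in A -> valid v) ->
  (forall v (i : 'I_k), v \in A -> codes i (j i) v) -> solution j.
Proof.
move=> h0 sA injA vA cA t tsh.
pose l0 := t %/ h; pose t0 := t %% h.
have l0s : l0 < s by rewrite ltn_divLR.
have t0h : t0 < h by rewrite ltn_pmod.
pose c (l : nat) : nat := \sum_(i < k) x i (j i) (l * h + t0).
(* The value of [P] at the [gamma] of a vertex of [A] is the sum of its symbols at place [t0] over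
   all blocks, which is zero by validity. *)
pose P : {poly 'F_q} := (\poly_(l < s) (c l)%:R)%R.
pose rs : seq 'F_q := [seq ((dig v k)%:R)%R | v : 'I_gap_order <- enum A].
have urs : uniq rs.
  rewrite map_inj_in_uniq ?enum_uniq // => v w; rewrite !mem_enum => vA' wA' e.
  by apply: injA => //; apply: natr_Fp_inj e; apply: dig_lt.
have rrs : all (root P) rs.
  apply/allP => z /mapP[v]; rewrite mem_enum => vinA ->.
  rewrite /root horner_poly.
  have /forallP/(_ (Ordinal t0h)) /= := vA v vinA.
  under eq_bigr => i _.
    have /forallP/(_ (Ordinal t0h))/eqP /= -> := cA v i vinA; over.
  rewrite /rs_code /dvdn modn_summ -/(dvdn _ _).
  rewrite (dvdn_pcharf (pchar_Fp q_pr)) exchange_big /= natr_sum.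
  congr (_ == _); apply: eq_bigr => l _.
  by rewrite /c -big_distrr /= natrM natrX mulrC.
have P0 : P = 0%R.
  apply: (@roots_geq_poly_eq0 _ _ rs) => //.
  by rewrite size_map -cardE; apply: leq_trans (size_poly _ _) sA.
have : (P`_l0 = 0)%R by rewrite P0 coef0.
rewrite coef_poly l0s => /eqP; rewrite -(dvdn_pcharf (pchar_Fp q_pr)).
by rewrite /c -divn_eq.
Qed.

(* A vertex with no neighbour in direction [i] is determined by its digits
   [j != i] together with digit [k]. *)
Lemma card_isolated (S : {set 'I_gap_order}) (i : 'I_k) :
  {in S &, forall v w : 'I_gap_order, v != w -> gap_adj v w} ->
  (forall v w : 'I_gap_order, v \in S -> w \in S ->
    (forall j : 'I_k, j != i -> dig v j = dig w j) -> dig v i = dig w i) ->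
  #|S| <= q ^ k.
Proof.
move=> cl iso.
(* Digit [i] is dropped and digit [k] stored in its place, so the image lies in a set of size
   [q ^ k]. *)
pose f (v : 'I_gap_order) : {ffun 'I_k -> 'I_q} :=
  [ffun j : 'I_k => Ordinal (dig_lt v (if j == i then k else j))].
have finj : {in S &, injective f}.
  move=> v w vS wS /ffunP fvw; apply/eqP; apply: contraT => vw.
  have dk : dig v k = dig w k.
    by have /(congr1 val) := fvw i; rewrite !ffunE /= eqxx.
  have dj (j : 'I_k) : j != i -> dig v j = dig w j.
    by have /(congr1 val) := fvw j; rewrite !ffunE /= => + /negbTE ji; rewrite ji.
  have di : dig v i = dig w i by apply: iso.
  have := cl v w vS wS vw; rewrite /gap_adj ndiff0 /=.
    by rewrite dk eqxx /= andbF !andbF.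
  by move=> j; case: (eqVneq j i) => [->|/dj].
rewrite -(card_in_imset finj) (leq_trans (max_card _)) //.
by rewrite card_ffun !card_ord.
Qed.

Theorem gap_sound (S : {set 'I_gap_order}) : 0 < h -> 0 < s ->
  {in S &, forall v w : 'I_gap_order, v != w -> gap_adj v w} ->
  (forall j, ~ solution j) -> #|S| < (k + s) * q ^ k.
Proof.
move=> h0 s0 cl nosol.
pose near (i : 'I_k) (v w : 'I_gap_order) :=
  [forall j : 'I_k, (j != i) ==> (dig v j == dig w j)].
(* The vertices of [S] that are alone on their line in direction [i]. *)
pose Iso i := [set v in S | [forall w in S, near i v w ==> (dig v i == dig w i)]].
pose S' := S :\: \bigcup_i Iso i.
have cIso i : #|Iso i| <= q ^ k.
  apply: (@card_isolated _ i).
    by move=> v w; rewrite !inE => /andP[vS _] /andP[wS _]; apply: cl.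
  move=> v w; rewrite !inE => /andP[vS /forallP hv] /andP[wS _] dj.
  have /implyP/(_ wS)/implyP nr := hv w; apply/eqP/nr.
  by apply/forallP => j; apply/implyP => /dj ->.
have cS : #|S| <= #|S'| + \sum_(i < k) #|Iso i|.
  apply: leq_trans (_ : #|S'| + #|\bigcup_i Iso i| <= _).
    rewrite -(cardsID (\bigcup_i Iso i) S) addnC leq_add2l.
    by apply: subset_leq_card; apply: subsetIr.
  rewrite leq_add2l.
  elim/big_rec2: _ => [|i m A _ hA]; first by rewrite cards0.
  by rewrite (leq_trans (leq_card_setU _ _)) // leq_add2l.
pose al (v : 'I_gap_order) : {ffun 'I_k -> 'I_q} :=
  [ffun j : 'I_k => Ordinal (dig_lt v j)].
have alE v w : al v = al w -> forall j : 'I_k, dig v j = dig w j.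
  by move=> /ffunP e j; have /(congr1 val) := e j; rewrite !ffunE.
(* Were there [s] vertices of [S'] over one [alpha], they would have [s] distinct [gamma]'s and
   yield a solution. *)
have fib a : #|[set v in S' | al v == a]| < s.
  rewrite ltnNge; apply/negP; set A := [set v in S' | _] => sA.
  have [v0 v0A] : exists v, v \in A by apply/card_gt0P; apply: leq_trans s0 sA.
  have AS v : v \in A -> v \in S by rewrite !inE => /andP[/andP[_ ->]].
  have Aal v w : v \in A -> w \in A -> forall j : 'I_k, dig v j = dig w j.
    by rewrite !inE => /andP[_ /eqP av] /andP[_ /eqP aw]; apply: alE; rewrite av.
  have topA v : v \in A -> top v = top v0.
    move=> vA; case: (eqVneq v v0) => [->//|vv0].
    have := cl v v0 (AS v vA) (AS _ v0A) vv0.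
    rewrite /gap_adj ndiff0 //=; last exact: Aal.
    by move=> /and3P[_ _ /andP[_ /andP[_ /eqP]]].
  (* A single witness [w] found for [v0] serves all of [A], whose elements share [alpha]. *)
  have nb (i : 'I_k) : exists w, [/\ w \in S,
      forall j : 'I_k, j != i -> dig v0 j = dig w j & dig v0 i != dig w i].
    have : v0 \notin Iso i.
      move: v0A; rewrite !inE => /andP[/andP[nv _] _].
      by apply: contra nv => h1; apply/bigcupP; exists i => //; rewrite inE.
    rewrite inE (AS _ v0A) /= negb_forall => /existsP[w].
    rewrite negb_imply => /andP[wS]; rewrite negb_imply => /andP[/forallP nr d].
    by exists w; split=> // j ji; apply/eqP; apply: (implyP (nr j)).
  have loc (i : 'I_k) : exists j : 'I_n, forall v, v \in A -> codes i j v.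
    have [w [wS dj di]] := nb i.
    have J v : v \in A -> joined i v w.
      move=> vA.
      have vi : dig v i != dig w i by rewrite (Aal v v0).
      have vw : v != w by apply: contraNneq vi => ->.
      have := cl v w (AS v vA) wS vw.
      rewrite /gap_adj (@ndiff1 v w i) //=; last first.
        by move=> j ji; rewrite (Aal v v0) // dj.
      move=> /and3P[_ _ /andP[/forallP/(_ i)]].
      by rewrite (negbTE vi).
    have /existsP[j0 /and3P[/eqP e0 _ _]] := J v0 v0A.
    exists j0 => v vA; have /existsP[j1 /and3P[/eqP e1 c1 _]] := J v vA.
    (* The elements of [A] also share [top], so both indices solve the same linear equation, whose
       coefficient is nonzero because digit [i] of [v0] and [w] differ. *)
    suff -> : j0 = j1 by [].
    move: e0 e1; rewrite (topA v vA) (Aal v v0) // => e0 e1; apply: val_inj => /=.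
    move: di e0 e1; nia.
  have [f fP] : exists f : 'I_k -> 'I_n, forall (i : 'I_k) v, v \in A -> codes i (f i) v.
    have loc' (i : 'I_k) : exists j : 'I_n, [forall v in A, codes i j v].
      by have [j hj] := loc i; exists j; apply/forall_inP.
    exists (fun i => xchoose (loc' i)) => i v.
    by have /forall_inP h1 := xchooseP (loc' i); apply: h1.
  apply: (nosol f); apply: (@solution_of_codes f A) => //.
  - move=> v w vA wA dk; apply/eqP; apply: contraT => vw.
    have := cl v w (AS v vA) (AS w wA) vw.
    by rewrite /gap_adj ndiff0 /= ?dk ?eqxx /= ?andbF ?andbF //; apply: Aal.
  - move=> v vA.
    (* For positive [k] validity is read off an edge of the clique; for [k = 0] it is an empty
       sum. *)
    have [|i] := posnP k; last first.
      have [w [wS dj di]] := nb (Ordinal i).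
      have vi : dig v (Ordinal i) != dig w (Ordinal i) by rewrite (Aal v v0).
      have vw : v != w by apply: contraNneq vi => ->.
      by have /and3P[] := cl v w (AS v vA) wS vw.
    move=> k0; apply/forallP => t; rewrite big1 ?dvdn0 // => i _.
    by have := ltn_ord i; rewrite {2}k0.
  - by move=> v i vA; apply: fP.
have cS' : #|S'| <= s.-1 * q ^ k.
  rewrite -sum1_card (partition_big al xpredT) //=.
  have -> : s.-1 * q ^ k = \sum_(a : {ffun 'I_k -> 'I_q}) s.-1.
    by rewrite sum_nat_const card_ffun !card_ord mulnC.
  apply: leq_sum => a _; rewrite sum1_card -ltnS prednK //.
  by apply: leq_ltn_trans (fib a); rewrite cardsE; apply: eq_leq; apply: eq_card.
have cI : \sum_(i < k) #|Iso i| <= k * q ^ k.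
  apply: (@leq_trans (\sum_(i < k) q ^ k)); first exact: leq_sum.
  by rewrite sum_nat_const card_ord.
have : 0 < q ^ k by rewrite expn_gt0 q_gt0.
(* The total is at most [s.-1 * q ^ k + k * q ^ k]. *)
move: cS cS' cI s0; case: s => // s1 /=; lia.
Qed.

Lemma dig_add a b L d : a < q ^ L -> dig (a + b * q ^ L) d =
  if d < L then dig a d else dig b (d - L).
Proof.
move=> aL; case: ltnP => dL.
  rewrite /dig -{1}(subnK (ltnW dL)) expnD mulnA divnDMl ?expn_gt0 ?q_gt0 //.
  by rewrite -modnDmr -(subnSK dL) expnS mulnCA modnMr addn0.
rewrite /dig -{1}(subnKC dL) expnD divnMA divnDMl ?expn_gt0 ?q_gt0 //.
by rewrite (divn_small aL) add0n.
Qed.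

Lemma digits_exist (f : nat -> nat) (L : nat) : (forall d, f d < q) ->
  exists2 v, v < q ^ L & forall d, d < L -> dig v d = f d.
Proof.
move=> fq; elim: L => [|L [v vL vd]]; first by exists 0.
exists (v + f L * q ^ L) => [|d].
  rewrite expnS; have := fq L; move: vL; nia.
rewrite ltnS dig_add // leq_eqVlt => /predU1P[->|dL]; last by rewrite dL vd.
by rewrite ltnn subnn /dig divn1 modn_small.
Qed.

Lemma dig_inj L a b : a < q ^ L -> b < q ^ L ->
  (forall d, d < L -> dig a d = dig b d) -> a = b.
Proof.
elim: L a b => [|L IHL] a b; first by rewrite expn0; case: a; case: b.
move=> aL bL e; rewrite (divn_eq a (q ^ L)) (divn_eq b (q ^ L)).
have E c : c < q ^ L.+1 -> c %/ q ^ L = dig c L.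
  by move=> cL; rewrite /dig modn_small // ltn_divLR ?expn_gt0 ?q_gt0 // -expnS.
have D c d : d < L -> dig (c %% q ^ L) d = dig c d.
  move=> dL; rewrite {2}(divn_eq c (q ^ L)) addnC dig_add ?dL //.
  by rewrite ltn_pmod ?expn_gt0 ?q_gt0.
rewrite !E // e // (IHL (a %% q ^ L) (b %% q ^ L)) ?ltn_pmod ?expn_gt0 ?q_gt0 //.
by move=> d dL; rewrite !D // e // ltnW.
Qed.

(** The clique takes the honest label of every group, where [g < q ^ (k + 1)] codes the pair
    [(alpha, gamma)] by its digits. *)
Theorem gap_complete (j : 'I_k -> 'I_n) : 0 < h -> solution j ->
  exists2 S : {set 'I_gap_order},
    {in S &, forall v w : 'I_gap_order, v != w -> gap_adj v w}
    & #|S| = q ^ (k + 1).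
Proof.
move=> h0 sol.
(* Extension of [j] by 0, since [digits_exist] asks for a digit at every natural number. *)
pose jx i : nat := if insub i is Some i' then j i' else 0.
have jxE (i : 'I_k) : jx i = j i by rewrite /jx valK.
pose X g := \sum_(i < k) dig g i * j i.
have Y g : exists2 y, y < q ^ (k * h) & forall i t, i < k -> t < h ->
    dig y (i * h + t) = rs_code (dig g k) i (jx i) t.
  have [|y y1 y2] := @digits_exist
    (fun d => rs_code (dig g k) (d %/ h) (jx (d %/ h)) (d %% h)) (k * h).
    by move=> d; rewrite ltn_pmod.
  exists y => // i t ik th; rewrite y2; last by nia.
  by rewrite divnMDl // divn_small // addn0 modnMDl modn_small.
(* A boolean statement over a finite type, so that [xchoose] selects one block of symbols for each
   [g]. *)
have YP g : exists y : 'I_(q ^ (k * h)), [forall i : 'I_k, forall t : 'I_h,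
    dig y (i * h + t) == rs_code (dig g k) i (j i) t].
  have [y y1 y2] := Y g; exists (Ordinal y1).
  by apply/forallP => i; apply/forallP => t; rewrite /= y2 // jxE.
pose y g : nat := xchoose (YP g).
have yP g (i : 'I_k) t : t < h -> dig (y g) (i * h + t) = rs_code (dig g k) i (j i) t.
  move=> th.
  by have /forallP/(_ i)/forallP/(_ (Ordinal th))/eqP := xchooseP (YP g).
pose v (g : nat) := g + (y g + X g * q ^ (k * h)) * q ^ (k + 1).
have vd g d : g < q ^ (k + 1) -> d < k + 1 -> dig (v g) d = dig g d.
  by move=> gq dk; rewrite dig_add ?dk.
have kk : k < k + 1 by rewrite addn1.
have vy g (i : 'I_k) t : g < q ^ (k + 1) -> t < h ->
    dig (v g) (k + 1 + i * h + t) = rs_code (dig (v g) k) i (j i) t.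
  move=> gq th; rewrite (vd g k gq kk) [LHS]dig_add //.
  rewrite ifN; last by rewrite -leqNgt -addnA leq_addr.
  rewrite -addnA addKn dig_add //; last exact: ltn_ord.
  by rewrite yP // ifT //; have := ltn_ord i; nia.
have vX g : g < q ^ (k + 1) -> top (v g) = X g.
  move=> gq; rewrite /top /offset expnD divnMA /v divnDMl ?expn_gt0 ?q_gt0 //.
  have yB : y g < q ^ (k * h) by apply: ltn_ord.
  by rewrite (divn_small gq) add0n divnDMl ?expn_gt0 ?q_gt0 // (divn_small yB).
have vN g : g < q ^ (k + 1) -> v g < gap_order.
  move=> gq.
  have XB : X g <= k * q * n.
    rewrite /X -mulnA -[X in X * _]card_ord -sum_nat_const.
    apply: leq_sum => i _; rewrite leq_mul // ltnW //; apply: dig_lt.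
  have yB : y g < q ^ (k * h) by apply: ltn_ord.
  rewrite /gap_order /offset expnD /v -mulnA mulnC [ltnRHS]mulnC.
  apply: (@leq_trans ((y g + X g * q ^ (k * h)).+1 * q ^ (k + 1))).
    by rewrite mulSn -addSn leq_add // mulnC.
  rewrite leq_mul2r; apply/orP; right.
  rewrite -addSn (@leq_trans (q ^ (k * h) + X g * q ^ (k * h))) ?leq_add2r //.
  by rewrite -mulSn mulnC leq_mul2l addn1 ltnS XB orbT.
have vinj g g' : g < q ^ (k + 1) -> g' < q ^ (k + 1) -> v g = v g' -> g = g'.
  move=> gq gq' e; rewrite -(modn_small gq) -(modn_small gq').
  by have := congr1 (modn^~ (q ^ (k + 1))) e; rewrite /v !(addnC _ (_ * _)) !modnMDl.
pose f (g : 'I_(q ^ (k + 1))) : 'I_gap_order := Ordinal (vN g (ltn_ord g)).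
exists [set f g | g in 'I_(q ^ (k + 1))]; last first.
  rewrite card_imset ?card_ord // => g g' /(congr1 val) /= e.
  exact: val_inj (vinj g g' (ltn_ord g) (ltn_ord g') e).
move=> _ _ /imsetP[g _ ->] /imsetP[g' _ ->] ne /=.
have gq := ltn_ord g; have gq' := ltn_ord g'.
(* Exchanging the sums leaves multiples of the coordinates of the vector sum, all divisible by
   [q]. *)
have val g0 : g0 < q ^ (k + 1) -> valid (v g0).
  move=> g0q; apply/forallP => t.
  under eq_bigr => i _ do rewrite vy //.
  rewrite /rs_code /dvdn modn_summ exchange_big /= -/(dvdn _ _).
  apply: dvdn_sum => l _; rewrite -big_distrr /= dvdn_mull //.
  by apply: sol; have := ltn_ord t; have := ltn_ord l; nia.
have cod g0 (i : 'I_k) : g0 < q ^ (k + 1) -> codes i (j i) (v g0).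
  by move=> g0q; apply/forallP => t; rewrite vy.
rewrite /gap_adj !val //=.
case: (ltnP 1 (ndiff _ _)) => //= nd; apply/andP; split.
  apply/forallP => i; case: eqVneq => //= di.
  apply/existsP; exists (j i); rewrite !cod // !vX // andbT.
  have other (l : 'I_k) : l != i -> dig g l = dig g' l.
    move=> li; apply/eqP; apply: contraTT nd => dl; rewrite -ltnNge /ndiff.
    rewrite (bigD1 i) //= di (bigD1 l) //= !vd ?addn1 ?ltnS ?(ltnW (ltn_ord _)) //.
    by rewrite dl.
  (* Only direction [i] differs, so the other terms of the two [X]'s cancel and [j i] explains the
     difference. *)
  rewrite /X (bigD1 i) //= [X in _ == _ + X](bigD1 i) //=.
  rewrite !vd ?addn1 ?ltnS ?(ltnW (ltn_ord _)) //.
  have -> : \sum_(l < k | l != i) dig g l * j l =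
            \sum_(l < k | l != i) dig g' l * j l.
    by apply: eq_bigr => l /other ->.
  by rewrite addnCA eqxx.
case: (posnP (ndiff _ _)) => //= nd0.
have dd (i : 'I_k) : dig g i = dig g' i.
  move/eqP: nd0; rewrite /ndiff sum_nat_eq0 => /forallP/(_ i)/=.
  by rewrite eqb0 negbK !vd ?addn1 ?ltnS ?(ltnW (ltn_ord _)) // => /eqP.
rewrite !vX // /X; apply/andP; split; last first.
  by apply/eqP/eq_bigr => i _; rewrite dd.
(* Equal [alpha] and equal [gamma] would give [g = g']. *)
apply: contraNneq ne; rewrite !vd ?addn1 // => dk; apply/eqP; congr f.
apply: val_inj; apply: (@dig_inj (k + 1)) => // d dk1.
case: (ltngtP d k) => [dk'||->//]; first exact: (dd (Ordinal dk')).
by move: dk1; lia.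
Qed.

End GapGraph.

(** * Compilation of bounded loop programs *)

(** Quantifying over every coin sequence, returned intact, expresses that the run tosses no coin. *)
Definition runs (p : prog) (s : state) (t : nat) (s' : state) : Prop :=
  forall r, exec p s r t s' r.

Lemma runs_seq p1 p2 s1 t1 s2 t2 s3 :
  runs p1 s1 t1 s2 -> runs p2 s2 t2 s3 -> runs (Seq p1 p2) s1 (t1 + t2) s3.
Proof. by move=> h1 h2 r; apply: exec_seq (h1 r) (h2 r). Qed.

Lemma runs_if x p1 p2 s t s' :
  runs (if reg s x == 0 then p2 else p1) s t s' -> runs (If x p1 p2) s t.+1 s'.
Proof. by move=> h r; apply: exec_if (h r). Qed.

Lemma runs_while0 x p s : reg s x = 0 -> runs (While x p) s 1 s.
Proof. by move=> h r; apply: exec_while0. Qed.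

Lemma runs_whileS x p s1 t1 s2 t2 s3 :
  reg s1 x <> 0 -> runs p s1 t1 s2 -> runs (While x p) s2 t2 s3 ->
  runs (While x p) s1 (t1 + t2).+1 s3.
Proof. by move=> h h1 h2 r; apply: exec_whileS h (h1 r) (h2 r). Qed.

Lemma runs_lit x b s : runs (Lit x b) s 1 (set_reg s x b).
Proof. by move=> r; constructor. Qed.

Lemma runs_add x y z s :
  runs (Add x y z) s 1 (set_reg s x (reg s y + reg s z)).
Proof. by move=> r; constructor. Qed.

Lemma runs_monus x y z s :
  runs (Monus x y z) s 1 (set_reg s x (reg s y - reg s z)).
Proof. by move=> r; constructor. Qed.

Lemma runs_read x y s : runs (Read x y) s 1 (set_reg s x (ram s (reg s y))).
Proof. by move=> r; constructor. Qed.

Lemma runs_write x y s :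
  runs (Write x y) s 1 (State (reg s) (upd (ram s) (reg s x) (reg s y))).
Proof. by move=> r; constructor. Qed.

Lemma upd_same f a b : upd f a b a = b.
Proof. by rewrite /upd eqxx. Qed.

Lemma upd_other f a b c : c != a -> upd f a b c = f c.
Proof. by rewrite /upd => /negbTE ->. Qed.

Definition move_reg (x y : nat) : prog := Seq (Lit x false) (Add x x y).

Lemma runs_move x y s : x != y ->
  exists2 s', runs (move_reg x y) s 2 s' &
    [/\ ram s' = ram s, reg s' x = reg s y
      & forall z, z != x -> reg s' z = reg s z].
Proof.
move=> xy; eexists; first by apply: runs_seq (runs_lit _ _ _) (runs_add _ _ _ _).
split=> //=; first by rewrite !upd_same upd_other // eq_sym.
by move=> z zx; rewrite !upd_other.
Qed.

(* Functions of an environment (de Bruijn indices) and of a read-only memory;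
   [App2 g f1 f2] evaluates [g] in the two-element environment. *)
Inductive fn :=
| V of nat
| K of nat
| Plus of fn & fn
| Minus of fn & fn
| Peek of fn
| Let of fn & fn
| Iter of fn & fn & fn
| App2 of fn & fn & fn.

Fixpoint eval (M : nat -> nat) (f : fn) (e : seq nat) : nat :=
  match f with
  | V i => nth 0 e i
  | K c => c
  | Plus f g => eval M f e + eval M g e
  | Minus f g => eval M f e - eval M g e
  | Peek f => M (eval M f e)
  | Let f g => eval M g (eval M f e :: e)
  | Iter c f g =>
      iteri (eval M c e) (fun j a => eval M g [:: j, a & e]) (eval M f e)
  | App2 g f1 f2 => eval M g [:: eval M f1 e; eval M f2 e]
  end.

(** Inner loop counts may depend on the loop state, so a body is constrained only at the indices and
    accumulator values that really occur. *)
Fixpoint loops_le (B : nat) (M : nat -> nat) (f : fn) (e : seq nat) : Prop :=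
  match f with
  | V _ | K _ => True
  | Plus f g | Minus f g => loops_le B M f e /\ loops_le B M g e
  | Peek f => loops_le B M f e
  | Let f g => loops_le B M f e /\ loops_le B M g (eval M f e :: e)
  | Iter c f g =>
      [/\ loops_le B M c e, loops_le B M f e, eval M c e <= B
        & forall j, j < eval M c e -> forall a,
          a = iteri j (fun j a => eval M g [:: j, a & e]) (eval M f e) ->
          loops_le B M g [:: j, a & e]]
  | App2 g f1 f2 => [/\ loops_le B M f1 e, loops_le B M f2 e
      & loops_le B M g [:: eval M f1 e; eval M f2 e]]
  end.

(** Coefficient of the running time. A constant [c] is built by [c] additions of 1, since the only
    literals are 0 and 1. *)
Fixpoint fn_size (f : fn) : nat :=
  match f with
  | V _ => 2
  | K c => c + 2
  | Plus f g | Minus f g => fn_size f + fn_size g + 1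
  | Peek f => fn_size f + 1
  | Let f g => fn_size f + fn_size g + 2
  | Iter c f g => fn_size c + fn_size f + fn_size g + 10
  | App2 g f1 f2 => fn_size g + fn_size f1 + fn_size f2 + 2
  end.

(** Exponent of the loop bound in the running time: all [Iter] nodes are counted, an upper bound for
    the nesting depth. *)
Fixpoint fn_depth (f : fn) : nat :=
  match f with
  | V _ | K _ => 0
  | Plus f g | Minus f g | Let f g => fn_depth f + fn_depth g
  | Peek f => fn_depth f
  | Iter c f g => (fn_depth c + fn_depth f + fn_depth g).+1
  | App2 g f1 f2 => fn_depth g + fn_depth f1 + fn_depth f2
  end.

Fixpoint add_many (d c : nat) : prog :=
  if c is c'.+1 then Seq (add_many d c') (Add d d d.+1)
  else Lit d.+1 true.

(** The registers [rs] hold the environment, [d] receives the result and everything from [d] on is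
    free. In a loop, [d] counts the remaining rounds, [d.+1] is the accumulator, [d.+2] the index
    and [d.+3] the value of the body. *)
Fixpoint compile (f : fn) (rs : seq nat) (d : nat) : prog :=
  match f with
  | V i => if i < size rs then move_reg d (nth 0 rs i) else Lit d false
  | K c => Seq (Lit d false) (add_many d c)
  | Plus f g =>
      Seq (compile f rs d) (Seq (compile g rs d.+1) (Add d d d.+1))
  | Minus f g =>
      Seq (compile f rs d) (Seq (compile g rs d.+1) (Monus d d d.+1))
  | Peek f => Seq (compile f rs d) (Read d d)
  | Let f g =>
      Seq (compile f rs d) (Seq (compile g (d :: rs) d.+1) (move_reg d d.+1))
  | Iter c f g =>
      Seq (compile c rs d) (Seq (compile f rs d.+1) (Seq (Lit d.+2 false)
        (Seq (While d
          (Seq (compile g [:: d.+2, d.+1 & rs] d.+3)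
          (Seq (move_reg d.+1 d.+3)
          (Seq (Lit d.+3 true)
          (Seq (Add d.+2 d.+2 d.+3) (Monus d d d.+3))))))
        (move_reg d d.+1))))
  | App2 g f1 f2 =>
      Seq (compile f1 rs d) (Seq (compile f2 rs d.+1)
        (Seq (compile g [:: d; d.+1] d.+2) (move_reg d d.+2)))
  end.

Lemma runs_add_many d c s : exists2 s', runs (add_many d c) s c.+1 s' &
  [/\ ram s' = ram s, reg s' d = reg s d + c, reg s' d.+1 = 1
    & forall z, z < d -> reg s' z = reg s z].
Proof.
elim: c => [|c [s' rs' [h1 h2 h3 h4]]] /=.
  eexists; first exact: runs_lit.
  split=> //=; rewrite ?upd_same // ?upd_other ?addn0 //; first by lia.
  by move=> z zd; rewrite upd_other //; lia.
eexists; first by rewrite -[c.+2]addn1; apply: runs_seq rs' (runs_add _ _ _ _).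
split=> //=; rewrite ?upd_same ?h2 ?h3 //; first by lia.
  by rewrite upd_other ?h3 //; lia.
by move=> z zd; rewrite upd_other ?h4 //; lia.
Qed.

Lemma map_regs (r r' : nat -> nat) d rs : all (gtn d) rs ->
  (forall z, z < d -> r' z = r z) -> map r' rs = map r rs.
Proof. by move=> /allP ad h; apply/eq_in_map => z /ad; apply: h. Qed.

Lemma all_gtn_trans d d' rs : d <= d' -> all (gtn d) rs -> all (gtn d') rs.
Proof. by move=> dd; apply: sub_all => z /= zd; apply: leq_trans zd dd. Qed.

Lemma leq_mul_exp B a n c m : 0 < B -> a <= c -> n <= m -> a * B ^ n <= c * B ^ m.
Proof. by move=> B0 ac nm; rewrite leq_mul // leq_pexp2l. Qed.

(** By induction on [f]. Preservation of the memory and of the registers below [d] lets each subterm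
    see the same environment; a loop costs one more factor [B]. *)
Lemma compileP (B : nat) (B0 : 0 < B) (f : fn) (rs : seq nat) (d : nat) (s : state) :
  all (gtn d) rs -> loops_le B (ram s) f (map (reg s) rs) ->
  exists s' t, [/\ runs (compile f rs d) s t s',
    t <= fn_size f * B ^ fn_depth f, ram s' = ram s,
    reg s' d = eval (ram s) f (map (reg s) rs)
    & forall z, z < d -> reg s' z = reg s z].
Proof.
elim: f rs d s => [i|c|f IHf g IHg|f IHf g IHg|f IHf|f IHf g IHg|c IHc f IHf g IHg
                   |g IHg f1 IH1 f2 IH2] rs d s rsd /=.
- move=> _; case: ifP => isz.
    have dn : d != nth 0 rs i.
      by have := allP rsd _ (mem_nth 0 isz); rewrite /= neq_ltn => ->; rewrite orbT.
    have [s' r' [h1 h2 h3]] := runs_move s dn.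
    exists s', 2; split=> //; first by rewrite h2 (nth_map 0).
    by move=> z zd; rewrite h3 // neq_ltn zd.
  exists (set_reg s d 0), 1; split=> //=; first exact: runs_lit.
    by rewrite upd_same nth_default // size_map leqNgt isz.
  by move=> z zd; rewrite upd_other // neq_ltn zd.
- move=> _; have [s' r' [h1 h2 h3 h4]] := runs_add_many d c (set_reg s d 0).
  exists s', (1 + c.+1); split=> //; first exact: (runs_seq (runs_lit d false s) r').
  + by rewrite expn0; lia.
  + by rewrite h2 /= upd_same.
  + by move=> z zd; rewrite h4 //= upd_other // neq_ltn zd.
- move=> [lf lg].
  have [s1 [t1 [r1 b1 m1 v1 o1]]] := IHf rs d s rsd lf.
  have e1 := map_regs rsd o1.
  have [|s2 [t2 [r2 b2 m2 v2 o2]]] := IHg rs d.+1 s1 (all_gtn_trans (leqnSn d) rsd).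
    by rewrite m1 e1.
  eexists; exists (t1 + (t2 + 1)); split.
  + by apply: runs_seq r1 _; apply: runs_seq r2 _; apply: runs_add.
  + rewrite !mulnDl mul1n addnA !leq_add ?expn_gt0 ?B0 //.
      by apply: leq_trans b1 _; rewrite leq_mul_exp ?leq_addr.
    by apply: leq_trans b2 _; rewrite leq_mul_exp ?leq_addl.
  + by rewrite /= m2.
  + by rewrite /= upd_same v2 o2 // v1 e1 m1.
  + by move=> z zd; rewrite /= upd_other ?o2 ?o1 //; lia.
- move=> [lf lg].
  have [s1 [t1 [r1 b1 m1 v1 o1]]] := IHf rs d s rsd lf.
  have e1 := map_regs rsd o1.
  have [|s2 [t2 [r2 b2 m2 v2 o2]]] := IHg rs d.+1 s1 (all_gtn_trans (leqnSn d) rsd).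
    by rewrite m1 e1.
  eexists; exists (t1 + (t2 + 1)); split.
  + by apply: runs_seq r1 _; apply: runs_seq r2 _; apply: runs_monus.
  + rewrite !mulnDl mul1n addnA !leq_add ?expn_gt0 ?B0 //.
      by apply: leq_trans b1 _; rewrite leq_mul_exp ?leq_addr.
    by apply: leq_trans b2 _; rewrite leq_mul_exp ?leq_addl.
  + by rewrite /= m2.
  + by rewrite /= upd_same v2 o2 // v1 e1 m1.
  + by move=> z zd; rewrite /= upd_other ?o2 ?o1 //; lia.
- move=> lf.
  have [s1 [t1 [r1 b1 m1 v1 o1]]] := IHf rs d s rsd lf.
  eexists; exists (t1 + 1); split.
  + by apply: runs_seq r1 _; apply: runs_read.
  + by rewrite mulnDl mul1n leq_add ?expn_gt0 ?B0.
  + by rewrite /= m1.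
  + by rewrite /= upd_same v1 m1.
  + by move=> z zd; rewrite /= upd_other ?o1 //; lia.
- move=> [lf lg].
  have [s1 [t1 [r1 b1 m1 v1 o1]]] := IHf rs d s rsd lf.
  have e1 := map_regs rsd o1.
  have [||s2 [t2 [r2 b2 m2 v2 o2]]] := IHg (d :: rs) d.+1 s1.
  + by rewrite /= leqnn (all_gtn_trans (leqnSn d) rsd).
  + by rewrite /= m1 e1 v1.
  have [|s3 r3 [m3 v3 o3]] := @runs_move d d.+1 s2; first by lia.
  exists s3, (t1 + (t2 + 2)); split.
  + by apply: runs_seq r1 _; apply: runs_seq r2 _.
  + rewrite !mulnDl addnA !leq_add //.
    * by apply: leq_trans b1 _; rewrite leq_mul_exp ?leq_addr.
    * by apply: leq_trans b2 _; rewrite leq_mul_exp ?leq_addl.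
    * by rewrite leq_pmulr // expn_gt0 B0.
  + by rewrite m3 m2.
  + by rewrite v3 v2 /= v1 e1 m1.
  + by move=> z zd; rewrite o3 ?o2 ?o1 //; lia.
- move=> [lc lf cB lg].
  have [s1 [t1 [r1 b1 m1 v1 o1]]] := IHc rs d s rsd lc.
  have e1 := map_regs rsd o1.
  have [|s2 [t2 [r2 b2 m2 v2 o2]]] := IHf rs d.+1 s1 (all_gtn_trans (leqnSn d) rsd).
    by rewrite m1 e1.
  have e2 : map (reg s2) rs = map (reg s) rs.
    by rewrite -e1; apply: map_regs (all_gtn_trans (leqnSn d) rsd) o2.
  set cnt := eval (ram s) c _ in cB lg v1 *.
  set stp := (fun j a => _) in lg *.
  set x0 := eval (ram s) f _ in lg *.
  set body := Seq (compile g _ _) _.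
  (* Invariant with [i] rounds remaining, hence [cnt - i] rounds done. *)
  have loop i s3 : i <= cnt -> reg s3 d = i -> reg s3 d.+2 = cnt - i ->
      reg s3 d.+1 = iteri (cnt - i) stp x0 -> ram s3 = ram s ->
      (forall z, z < d -> reg s3 z = reg s z) ->
    exists s' t, [/\ runs (While d body) s3 t s',
      t <= i * (fn_size g * B ^ fn_depth g + 6) + 1,
      ram s' = ram s, reg s' d.+1 = iteri cnt stp x0
      & forall z, z < d -> reg s' z = reg s z].
    elim: i s3 => [|i IHi] s3 ic ri rj ra m3 o3.
      exists s3, 1; split=> //; first exact: runs_while0.
      by rewrite ra subn0.
    have e3 := map_regs rsd o3.
    have [||s4 [t4 [r4 b4 m4 v4 o4]]] := IHg [:: d.+2, d.+1 & rs] d.+3 s3.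
    + by rewrite /= !ltnS leqnn leqnSn (@all_gtn_trans d) //; lia.
    + rewrite /= m3 e3 rj ra; apply: lg => //; lia.
    have [|s5 r5 [m5 v5 o5]] := @runs_move d.+1 d.+3 s4; first by lia.
    pose s6 := set_reg s5 d.+3 1.
    pose s7 := set_reg s6 d.+2 (reg s6 d.+2 + reg s6 d.+3).
    pose s8 := set_reg s7 d (reg s7 d - reg s7 d.+3).
    have d5 : reg s5 d = i.+1 by rewrite o5 ?o4 ?ri //; lia.
    have d52 : reg s5 d.+2 = cnt - i.+1 by rewrite o5 ?o4 ?rj //; lia.
    have e7 : reg s7 d = i.+1 by rewrite /= !upd_other ?d5; lia.
    have e73 : reg s7 d.+3 = 1 by rewrite /= upd_other ?upd_same; lia.
    have e72 : reg s7 d.+2 = (cnt - i.+1).+1.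
      by rewrite /= !upd_same upd_other ?d52; lia.
    have [||||||s9 [t9 [r9 b9 m9 v9 o9]]] := IHi s8.
    + exact: ltnW.
    + by rewrite [LHS]upd_same e7 e73 subn1.
    + by rewrite [LHS]upd_other ?e72; lia.
    + rewrite /= !upd_other ?v5 ?v4; try lia.
      have -> : cnt - i = (cnt - i.+1).+1 by lia.
      by rewrite /= rj ra e3 m3.
    + by rewrite /= m5 m4.
    + by move=> z zd; rewrite /= !upd_other ?o5 ?o4 ?o3; lia.
    (* Besides the body, a round costs two units for the move, three for single instructions and one
       for the test, whence the 6 in the bound. *)
    exists s9, ((t4 + (2 + (1 + (1 + 1)))) + t9).+1; split=> //.
    + apply: runs_whileS r9; first by rewrite ri.
      apply: runs_seq r4 _; apply: runs_seq r5 _.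
      apply: runs_seq (runs_lit _ _ _) _.
      by apply: runs_seq (runs_add _ _ _ _) (runs_monus _ _ _ _).
    + by rewrite mulSn; lia.
  have [||||||s9 [t9 [r9 b9 m9 v9 o9]]] := loop cnt (set_reg s2 d.+2 0).
  + exact: leqnn.
  + by rewrite /= upd_other ?o2 ?v1 //; lia.
  + by rewrite /= upd_same subnn.
  + by rewrite /= subnn upd_other ?v2 ?e1 ?m1 //; lia.
  + by rewrite /= m2.
  + by move=> z zd; rewrite /= upd_other ?o2 ?o1 //; lia.
  have [|s10 r10 [m10 v10 o10]] := @runs_move d d.+1 s9; first by lia.
  exists s10, (t1 + (t2 + (1 + (t9 + 2)))); split.
  + apply: runs_seq r1 _; apply: runs_seq r2 _.
    by apply: runs_seq (runs_lit _ _ _) _; apply: runs_seq r9 r10.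
  + pose D := (fn_depth c + fn_depth f + fn_depth g).+1; rewrite -/D.
    have P0 : 0 < B ^ D by rewrite expn_gt0 B0.
    have h1 : t1 <= fn_size c * B ^ D.
      by apply: leq_trans b1 _; rewrite leq_mul_exp // /D; lia.
    have h2 : t2 <= fn_size f * B ^ D.
      by apply: leq_trans b2 _; rewrite leq_mul_exp // /D; lia.
    have h3 : cnt * (fn_size g * B ^ fn_depth g) <= fn_size g * B ^ D.
      apply: (@leq_trans (B * (fn_size g * B ^ fn_depth g))).
        by rewrite leq_mul2r cB orbT.
      by rewrite mulnCA -expnS leq_mul_exp // /D; lia.
    have h4 : cnt <= B ^ D.
      by apply: leq_trans cB _; rewrite -[X in X <= _]expn1 leq_pexp2l.
    rewrite !mulnDl; move: h1 h2 h3 h4 b9 P0; rewrite mulnDr; lia.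
  + by rewrite m10.
  + by rewrite v10 v9.
  + by move=> z zd; rewrite o10 ?o9 //; lia.
- move=> [l1 l2 lg].
  have [s1 [t1 [r1 b1 m1 v1 o1]]] := IH1 rs d s rsd l1.
  have e1 := map_regs rsd o1.
  have [|s2 [t2 [r2 b2 m2 v2 o2]]] := IH2 rs d.+1 s1 (all_gtn_trans (leqnSn d) rsd).
    by rewrite m1 e1.
  have [||s3 [t3 [r3 b3 m3 v3 o3]]] := IHg [:: d; d.+1] d.+2 s2.
  + by rewrite /= !ltnS leqnn leqnSn.
  + by rewrite /= v2 o2 // v1 m2 e1 m1.
  have [|s4 r4 [m4 v4 o4]] := @runs_move d d.+2 s3; first by lia.
  exists s4, (t1 + (t2 + (t3 + 2))); split.
  + by do 3!(apply: runs_seq; first by eassumption).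
  + have h1 : t1 <= fn_size f1 * B ^ (fn_depth g + fn_depth f1 + fn_depth f2).
      by apply: leq_trans b1 _; rewrite leq_mul_exp //; lia.
    have h2 : t2 <= fn_size f2 * B ^ (fn_depth g + fn_depth f1 + fn_depth f2).
      by apply: leq_trans b2 _; rewrite leq_mul_exp //; lia.
    have h3 : t3 <= fn_size g * B ^ (fn_depth g + fn_depth f1 + fn_depth f2).
      by apply: leq_trans b3 _; rewrite leq_mul_exp //; lia.
    have P0 : 0 < B ^ (fn_depth g + fn_depth f1 + fn_depth f2).
      by rewrite expn_gt0 B0.
    by rewrite !mulnDl; lia.
  + by rewrite m4 m3 m2.
  + by rewrite v4 v3 /= v2 o2 // v1 m2 e1 m1.
  + by move=> z zd; rewrite o4 ?o3 ?o2 ?o1 //; lia.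
Qed.

(** * Loops that write to memory *)

Definition store_loop (c a v : fn) (rs : seq nat) (d : nat) : prog :=
  Seq (compile c rs d) (Seq (Lit d.+1 false)
    (While d
      (Seq (compile a (d.+1 :: rs) d.+2)
      (Seq (compile v (d.+1 :: rs) d.+3)
      (Seq (Write d.+2 d.+3)
      (Seq (Lit d.+2 true)
      (Seq (Add d.+1 d.+1 d.+2) (Monus d d d.+2)))))))).

(** Address and value are evaluated in the current memory, so a round sees the effect of earlier
    rounds. *)
Definition store_mem (a v : fn) (e : seq nat) (M : nat -> nat) (j : nat) :=
  iteri j (fun j M => upd M (eval M a (j :: e)) (eval M v (j :: e))) M.

Lemma store_mem_miss a v e M c z :
  (forall j M', j < c -> eval M' a (j :: e) != z) ->
  store_mem a v e M c z = M z.
Proof.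
elim: c => //= c IHc hz.
rewrite upd_other; last by rewrite eq_sym; apply: hz.
by apply: IHc => j M' jc; apply: hz; apply: ltnW.
Qed.

(** Addresses given by an injective function of the round are never overwritten later, so the cell
    keeps what round [j] wrote. *)
Lemma store_mem_hit a v e M c (A : nat -> nat) j :
  (forall j M', eval M' a (j :: e) = A j) -> injective A -> j < c ->
  store_mem a v e M c (A j) = eval (store_mem a v e M j) v (j :: e).
Proof.
move=> hA injA; elim: c => // c IHc; rewrite ltnS leq_eqVlt => /predU1P[->|jc].
  by rewrite /= hA upd_same.
by rewrite /= hA upd_other ?IHc // (inj_eq injA) neq_ltn jc.
Qed.

Lemma store_loopP (B : nat) (B0 : 0 < B) (c a v : fn) (rs : seq nat) (d : nat)
    (s : state) :
  all (gtn d) rs -> let e := map (reg s) rs in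
  loops_le B (ram s) c e -> eval (ram s) c e <= B ->
  (forall j, j < eval (ram s) c e -> forall M,
    M = store_mem a v e (ram s) j ->
    loops_le B M a (j :: e) /\ loops_le B M v (j :: e)) ->
  exists s' t, [/\ runs (store_loop c a v rs d) s t s',
    t <= (fn_size c + fn_size a + fn_size v + 10) *
      B ^ (fn_depth c + fn_depth a + fn_depth v).+1,
    ram s' = store_mem a v e (ram s) (eval (ram s) c e)
    & forall z, z < d -> reg s' z = reg s z].
Proof.
move=> rsd e lc; set cnt := eval _ _ _ => cB lav.
have [s1 [t1 [r1 b1 m1 v1 o1]]] := compileP B0 rsd lc.
rewrite /store_loop; set body := Seq (compile a _ _) _.
pose X := fn_size a * B ^ fn_depth a + fn_size v * B ^ fn_depth v + 5.
have loop i s3 : i <= cnt -> reg s3 d = i -> reg s3 d.+1 = cnt - i ->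
    ram s3 = store_mem a v e (ram s) (cnt - i) ->
    (forall z, z < d -> reg s3 z = reg s z) ->
  exists s' t, [/\ runs (While d body) s3 t s',
    t <= i * X + 1, ram s' = store_mem a v e (ram s) cnt
    & forall z, z < d -> reg s' z = reg s z].
  elim: i s3 => [|i IHi] s3 ic ri rj m3 o3.
    exists s3, 1; split=> //; first exact: runs_while0.
    by rewrite m3 subn0.
  have e3 : map (reg s3) rs = e := map_regs rsd o3.
  have [|la lv] := lav (cnt - i.+1) _ _ m3; first lia.
  have [||s4 [t4 [r4 b4 m4 v4 o4]]] := @compileP B B0 a (d.+1 :: rs) d.+2 s3.
  - by rewrite /= ltnS leqnn (@all_gtn_trans d) //; lia.
  - by rewrite /= e3 rj.
  have o4' z : z < d.+1 -> reg s4 z = reg s3 z by move=> ?; rewrite o4 //; lia.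
  have e4 : map (reg s4) rs = e.
    by rewrite -e3; apply: map_regs rsd _ => z zd; apply: o4'; lia.
  have [||s5 [t5 [r5 b5 m5 v5 o5]]] := @compileP B B0 v (d.+1 :: rs) d.+3 s4.
  - by rewrite /= !ltnS leqnSn (@all_gtn_trans d) //; lia.
  - by rewrite /= e4 m4 o4 // rj.
  pose s6 := State (reg s5) (upd (ram s5) (reg s5 d.+2) (reg s5 d.+3)).
  pose s7 := set_reg s6 d.+2 1.
  pose s8 := set_reg s7 d.+1 (reg s7 d.+1 + reg s7 d.+2).
  pose s9 := set_reg s8 d (reg s8 d - reg s8 d.+2).
  have d5 : reg s5 d = i.+1 by rewrite o5 ?o4' ?ri //; lia.
  have d51 : reg s5 d.+1 = cnt - i.+1 by rewrite o5 ?o4 ?rj //; lia.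
  have e8 : reg s8 d = i.+1 by rewrite /= !upd_other ?d5; lia.
  have e82 : reg s8 d.+2 = 1 by rewrite /= upd_other ?upd_same; lia.
  have e81 : reg s8 d.+1 = (cnt - i.+1).+1.
    by rewrite /= !upd_same upd_other ?d51; lia.
  have [|||||s10 [t10 [r10 b10 m10 o10]]] := IHi s9.
  - exact: ltnW.
  - by rewrite [LHS]upd_same e8 e82 subn1.
  - by rewrite [LHS]upd_other ?e81; lia.
  - rewrite /= m5 m4.
    have -> : cnt - i = (cnt - i.+1).+1 by lia.
    rewrite [RHS]/= -/(store_mem a v e (ram s) (cnt - i.+1)) -m3.
    by rewrite o5 // v4 /= e3 rj v5 /= e4 o4 // rj m4.
  - by move=> z zd; rewrite /= !upd_other ?o5 ?o4 ?o3; lia.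
  exists s10, ((t4 + (t5 + (1 + (1 + (1 + 1))))) + t10).+1; split=> //.
  - apply: runs_whileS r10; first by rewrite ri.
    apply: runs_seq r4 _; apply: runs_seq r5 _.
    apply: runs_seq (runs_write _ _ _) _.
    apply: runs_seq (runs_lit _ _ _) _.
    by apply: runs_seq (runs_add _ _ _ _) (runs_monus _ _ _ _).
  - by rewrite mulSn /X; lia.
have [|||||s2 [t2 [r2 b2 m2 o2]]] := loop cnt (set_reg s1 d.+1 0).
- exact: leqnn.
- by rewrite /= upd_other ?v1 //; lia.
- by rewrite /= upd_same subnn.
- by rewrite /= m1 subnn.
- by move=> z zd; rewrite /= upd_other ?o1 //; lia.
exists s2, (t1 + (1 + t2)); split=> //.
  by apply: runs_seq r1 _; exact: (runs_seq (runs_lit d.+1 false s1) r2).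
pose D := (fn_depth c + fn_depth a + fn_depth v).+1; rewrite -/D.
have P0 : 0 < B ^ D by rewrite expn_gt0 B0.
have h1 : t1 <= fn_size c * B ^ D.
  by apply: leq_trans b1 _; rewrite leq_mul_exp // /D; lia.
have h f : fn_depth f < D -> cnt * (fn_size f * B ^ fn_depth f) <= fn_size f * B ^ D.
  move=> fD; apply: (@leq_trans (B * (fn_size f * B ^ fn_depth f))).
    by rewrite leq_mul2r cB orbT.
  by rewrite mulnCA -expnS leq_mul_exp.
have ha : cnt * (fn_size a * B ^ fn_depth a) <= fn_size a * B ^ D.
  by apply: h; rewrite /D; lia.
have hv : cnt * (fn_size v * B ^ fn_depth v) <= fn_size v * B ^ D.
  by apply: h; rewrite /D; lia.
have h4 : cnt <= B ^ D.
  by apply: leq_trans cB _; rewrite -[X in X <= _]expn1 leq_pexp2l.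
rewrite !mulnDl; move: h1 ha hv h4 b2 P0; rewrite /X !mulnDr; lia.
Qed.

(** * Decision trees *)

Fixpoint switch (x y B : nat) (leaf : nat -> prog) (dflt : prog) : prog :=
  if B is B'.+1 then
    If x (Seq (Lit y true) (Seq (Monus x x y)
           (switch x y B' (fun v => leaf v.+1) dflt)))
      (leaf 0)
  else dflt.

(** Counting [x] down selects the branch. The result is stated relative to an arbitrary run of the
    chosen branch, so that trees compose. *)
Lemma switchP (x y B : nat) (leaf : nat -> prog) (dflt : prog) (s : state) :
  x != y -> exists s0, [/\ ram s0 = ram s,
    forall z, z != x -> z != y -> reg s0 z = reg s z &
    if reg s x < B then forall t s', runs (leaf (reg s x)) s0 t s' ->
      runs (switch x y B leaf dflt) s (3 * reg s x + 1 + t) s'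
    else forall t s', runs dflt s0 t s' ->
      runs (switch x y B leaf dflt) s (3 * B + t) s'].
Proof.
move=> xy; elim: B leaf s => [|B IHB] leaf s /=; first by exists s.
case E: (reg s x) => [|v].
  exists s; split=> // t s' h; rewrite muln0 add0n add1n.
  by apply: runs_if; rewrite E.
pose s1 := set_reg s y 1; pose s2 := set_reg s1 x (reg s1 x - reg s1 y).
have e2 : reg s2 x = v by rewrite /= !upd_same upd_other // E subn1.
have [s0 [h1 h2 h3]] := IHB (fun v => leaf v.+1) s2.
exists s0; split; first by rewrite h1.
  by move=> z zx zy; rewrite h2 // /= !upd_other.
rewrite e2 in h3; rewrite ltnS; case: ifP h3 => vB h3 t s' /h3 h.
  have -> : 3 * v.+1 + 1 + t = (1 + (1 + (3 * v + 1 + t))).+1 by lia.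
  apply: runs_if; rewrite E.
  exact: (runs_seq (runs_lit y true s) (runs_seq (runs_monus x x y s1) h)).
have -> : 3 * B.+1 + t = (1 + (1 + (3 * B + t))).+1 by lia.
apply: runs_if; rewrite E.
exact: (runs_seq (runs_lit y true s) (runs_seq (runs_monus x x y s1) h)).
Qed.

(* Register 3 is the input pointer; registers 1 and 2 are scratch. *)
Definition read_switch (B : nat) (leaf : nat -> prog) (dflt : prog) : prog :=
  Seq (Read 1 3) (Seq (Lit 2 true) (Seq (Add 3 3 2) (switch 1 2 B leaf dflt))).

Lemma read_switchP (B : nat) (leaf : nat -> prog) (dflt : prog) (s : state) :
  let v := ram s (reg s 3) in
  exists s0, [/\ ram s0 = ram s, reg s0 3 = (reg s 3).+1 &
    if v < B then forall t s', runs (leaf v) s0 t s' ->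
      runs (read_switch B leaf dflt) s (3 * v + 4 + t) s'
    else forall t s', runs dflt s0 t s' ->
      runs (read_switch B leaf dflt) s (3 * B + 3 + t) s'].
Proof.
move=> v; pose s1 := set_reg s 1 v; pose s2 := set_reg s1 2 1.
pose s3 := set_reg s2 3 (reg s2 3 + reg s2 2).
have [s0 [h1 h2 h3]] := @switchP 1 2 B leaf dflt s3 isT.
exists s0; split; first by rewrite h1.
  by rewrite h2 //= /upd /= addn1.
have e3 : reg s3 1 = v by [].
rewrite e3 in h3; case: ifP h3 => vB h3 t s' /h3 h.
  have -> : 3 * v + 4 + t = 1 + (1 + (1 + (3 * v + 1 + t))) by lia.
  apply: runs_seq (runs_read _ _ _) _.
  exact: (runs_seq (runs_lit 2 true s1) (runs_seq (runs_add 3 3 2 s2) h)).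
have -> : 3 * B + 3 + t = 1 + (1 + (1 + (3 * B + t))) by lia.
apply: runs_seq (runs_read _ _ _) _.
exact: (runs_seq (runs_lit 2 true s1) (runs_seq (runs_add 3 3 2 s2) h)).
Qed.

(** The leaf depends on the whole word read, so the tree hard-wires a table indexed by words. *)
Fixpoint read_tree (B L : nat) (leaf : seq nat -> prog) : prog :=
  if L is L'.+1 then
    read_switch B (fun v => read_tree B L' (fun w => leaf (v :: w))) (Lit 2 true)
  else leaf [::].

Lemma read_treeP (B L : nat) (leaf : seq nat -> prog) (s : state) (w : seq nat) :
  size w = L -> all (gtn B) w ->
  (forall i, i < L -> ram s (reg s 3 + i) = nth 0 w i) ->
  exists s0 t0, [/\ ram s0 = ram s, t0 <= L * (3 * B + 4) &
    forall t s', runs (leaf w) s0 t s' ->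
      runs (read_tree B L leaf) s (t0 + t) s'].
Proof.
elim: L w leaf s => [|L IHL] [|x w] // leaf s; first by exists s, 0.
move=> [szw] /= /andP[xB wB] hw.
have [s1 [h1 h2]] := read_switchP B
  (fun v => read_tree B L (fun w => leaf (v :: w))) (Lit 2 true) s.
have := hw 0 isT; rewrite addn0 /= => ->; rewrite xB => h3.
have [i iL|s0 [t0 [g1 g2 g3]]] := IHL w (fun w => leaf (x :: w)) s1 szw wB.
  by rewrite h1 h2 addSnnS; apply: (hw i.+1).
exists s0, (3 * x + 4 + t0); split; first by rewrite g1.
  by rewrite mulSn; move: xB g2 => /=; lia.
by move=> t s' /g3/h3; rewrite addnA.
Qed.

(** * Programs for the gap graph *)

(** Repeated addition, looping on the first factor: only that factor has to respect the loop
    bound. *)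
Definition mul_fn : fn := Iter (V 0) (K 0) (Plus (V 1) (V 3)).
Definition Mul (f g : fn) : fn := App2 mul_fn f g.
Definition pow_fn : fn := Iter (V 1) (K 1) (Mul (V 2) (V 1)).
Definition Pow (f g : fn) : fn := App2 pow_fn f g.
Definition Lt (f g : fn) : fn := Minus (K 1) (Minus (K 1) (Minus g f)).
Definition eq_fn : fn :=
  Minus (K 1) (Plus (Minus (V 0) (V 1)) (Minus (V 1) (V 0))).
Definition Eq (f g : fn) : fn := App2 eq_fn f g.
(** The quotient of [a] by [b] is the number of [i < a] with [i.+1 * b <= a]. *)
Definition div_fn : fn := Iter (V 0) (K 0)
  (Plus (V 1) (Minus (K 1) (Minus (Mul (Plus (V 0) (K 1)) (V 3)) (V 2)))).
Definition Div (f g : fn) : fn := App2 div_fn f g.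
Definition mod_fn : fn := Minus (V 0) (Mul (Div (V 0) (V 1)) (V 1)).
Definition Mod (f g : fn) : fn := App2 mod_fn f g.
Definition Not (f : fn) : fn := Minus (K 1) f.
Definition Or (f g : fn) : fn := Lt (K 0) (Plus f g).
(** The body sees the index at position 0 and the accumulator at position 1. Outer variables thus
    move by two under [Sum] and by one under [Let], which explains the shifts [.+2] and [.+3]
    further on. *)
Definition Sum (c f : fn) : fn := Iter c (K 0) (Plus (V 1) f).

Section Eval.
Variable M : nat -> nat.

Lemma eval_V i e : eval M (V i) e = nth 0 e i. Proof. by []. Qed.
Lemma eval_K c e : eval M (K c) e = c. Proof. by []. Qed.
Lemma eval_Plus f g e : eval M (Plus f g) e = eval M f e + eval M g e.
Proof. by []. Qed.
Lemma eval_Minus f g e : eval M (Minus f g) e = eval M f e - eval M g e.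
Proof. by []. Qed.
Lemma eval_Peek f e : eval M (Peek f) e = M (eval M f e). Proof. by []. Qed.
Lemma eval_Let f g e : eval M (Let f g) e = eval M g (eval M f e :: e).
Proof. by []. Qed.

Lemma eval_Mul f g e : eval M (Mul f g) e = eval M f e * eval M g e.
Proof.
rewrite /Mul /mul_fn /=; move: (eval M f e) (eval M g e) => a b.
by elim: a => //= a ->; rewrite mulSn addnC.
Qed.

Lemma eval_Pow f g e : eval M (Pow f g) e = eval M f e ^ eval M g e.
Proof.
rewrite /Pow; cbn -[Mul]; move: (eval M f e) (eval M g e) => a b.
elim: b => // b; cbn -[Mul] => ->.
by rewrite eval_Mul expnS.
Qed.

Lemma eval_Lt f g e : eval M (Lt f g) e = (eval M f e < eval M g e).
Proof. by rewrite /Lt /=; case: ltnP; lia. Qed.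

Lemma eval_Eq f g e : eval M (Eq f g) e = (eval M f e == eval M g e).
Proof. by rewrite /Eq /eq_fn /=; case: eqP; lia. Qed.

Lemma eval_Sum c f F e :
  (forall i a, i < eval M c e -> eval M f [:: i, a & e] = F i) ->
  eval M (Sum c f) e = \sum_(i < eval M c e) F i.
Proof.
move=> h; rewrite /Sum /=; elim: (eval M c e) h => [|m IHm] h.
  by rewrite big_ord0.
by rewrite big_ord_recr /= h // IHm // => i a im; apply: h; apply: ltnW.
Qed.

Lemma sum_leq_divn a b : 0 < b -> \sum_(i < a) (i.+1 * b <= a) = a %/ b.
Proof.
move=> b0; under eq_bigr => i _ do rewrite -leq_divRL //.
have e c d : \sum_(i < c) (i < d) = minn c d.
  elim: c => [|c IHc]; first by rewrite big_ord0 min0n.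
  by rewrite big_ord_recr /= IHc; case: ltnP; lia.
by rewrite e; apply/minn_idPr/leq_div.
Qed.

Lemma eval_Div f g e : 0 < eval M g e ->
  eval M (Div f g) e = eval M f e %/ eval M g e.
Proof.
rewrite /Div; cbn -[Mul div_fn]; move: (eval M f e) (eval M g e) => a b b0.
rewrite /div_fn (@eval_Sum _ _ (fun i => i.+1 * b <= a : nat)).
  by rewrite eval_V /= sum_leq_divn.
move=> i c _; rewrite !(eval_Minus, eval_Mul, eval_Plus, eval_K, eval_V) /= addn1.
by case: leqP; lia.
Qed.

Lemma eval_Mod f g e : 0 < eval M g e ->
  eval M (Mod f g) e = eval M f e %% eval M g e.
Proof.
rewrite /Mod; cbn -[Mul mod_fn]; move: (eval M f e) (eval M g e) => a b b0.
rewrite /mod_fn eval_Minus eval_Mul eval_Div // !eval_V /=.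
by rewrite {1}(divn_eq a b) addKn.
Qed.

Lemma eval_Not f e (b : bool) : eval M f e = b -> eval M (Not f) e = ~~ b.
Proof. by rewrite /Not /= => ->; case: b. Qed.

Variable B : nat.

Lemma loops_Mul f g e : loops_le B M f e -> loops_le B M g e ->
  eval M f e <= B -> loops_le B M (Mul f g) e.
Proof. by move=> ? ? ?; split. Qed.

Lemma loops_Pow f g e : loops_le B M f e -> loops_le B M g e ->
  eval M f e <= B -> eval M g e <= B -> loops_le B M (Pow f g) e.
Proof.
by move=> hf hg fB gB; split=> //; split.
Qed.

Lemma loops_Lt f g e : loops_le B M f e -> loops_le B M g e ->
  loops_le B M (Lt f g) e.
Proof. by []. Qed.

Lemma loops_Eq f g e : loops_le B M f e -> loops_le B M g e ->
  loops_le B M (Eq f g) e.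
Proof. by []. Qed.

Lemma loops_Sum c f e : loops_le B M c e -> eval M c e <= B ->
  (forall i a, i < eval M c e -> loops_le B M f [:: i, a & e]) ->
  loops_le B M (Sum c f) e.
Proof. by move=> ? ? h; split=> // j ? a _; split=> //; apply: h. Qed.

Lemma loops_Div f g e : loops_le B M f e -> loops_le B M g e ->
  eval M f e <= B -> loops_le B M (Div f g) e.
Proof.
move=> hf hg fB; split=> //; apply: loops_Sum => // i a.
move=> ia; split=> //; split=> //; apply: loops_Mul => //.
by rewrite /= addn1 (leq_trans ia).
Qed.

Lemma loops_Mod f g e : loops_le B M f e -> loops_le B M g e ->
  eval M f e <= B -> 0 < eval M g e -> loops_le B M (Mod f g) e.
Proof.
move=> hf hg fB g0; split=> //; split=> //; apply: loops_Mul => //.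
  exact: loops_Div.
by rewrite eval_Div //= (leq_trans (leq_div _ _)).
Qed.

End Eval.

(** * Computing adjacency *)

Section Reduction.
Variables q k s : nat.

Definition Dig (f g : fn) : fn := Mod (Div f (Pow (K q) g)) (K q).

(* In the functions below [p] is the position in the environment of the five
   globals [n; m; h; N; D] ([N] vertices, [D] the address of the copied input);
   the other arguments are positions of local variables. *)

Definition coord_fn (p i j t : nat) : fn :=
  Mul (Lt (V t) (V (p + 1)))
    (Peek (Plus (Plus (V (p + 4)) (K 2))
      (Plus (Mul (Plus (Mul (V i) (V (p + 0))) (V j)) (V (p + 1))) (V t)))).

Definition rs_code_fn (p g i j t : nat) : fn :=
  Mod (Sum (K s) (Mul (Pow (V g.+2) (V 0))
    (Let (Plus (Mul (V 0) (V (p.+2 + 2))) (V t.+2))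
       (coord_fn p.+3 i.+3 j.+3 0)))) (K q).

Definition label_fn (p v i t : nat) : fn :=
  Dig (V v) (Plus (Plus (K (k + 1)) (Mul (V i) (V (p + 2)))) (V t)).

(** Bounded universal quantifiers are computed by checking that the number of counterexamples is
    below 1. *)
Definition codes_fn (p i j v : nat) : fn :=
  Lt (Sum (V (p + 2)) (Not (Eq (label_fn p.+2 v.+2 i.+2 0)
    (Let (Dig (V v.+2) (K k)) (rs_code_fn p.+3 0 i.+3 j.+3 1))))) (K 1).

Definition valid_fn (p v : nat) : fn :=
  Lt (Sum (V (p + 2))
    (Mod (Sum (K k) (label_fn p.+4 v.+4 0 2)) (K q))) (K 1).

Definition top_fn (p v : nat) : fn :=
  Div (V v) (Pow (K q) (Plus (K (k + 1)) (Mul (K k) (V (p + 2))))).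

Definition joined_fn (p i v w : nat) : fn :=
  Lt (K 0) (Sum (V (p + 0))
    (Mul (Eq (Plus (Mul (Dig (V v.+2) (V i.+2)) (V 0)) (top_fn p.+2 w.+2))
             (Plus (Mul (Dig (V w.+2) (V i.+2)) (V 0)) (top_fn p.+2 v.+2)))
      (Mul (codes_fn p.+2 i.+2 0 v.+2) (codes_fn p.+2 i.+2 0 w.+2)))).

Definition ndiff_fn (v w : nat) : fn :=
  Sum (K k) (Not (Eq (Dig (V v.+2) (V 0)) (Dig (V w.+2) (V 0)))).

Definition all_joined_fn (p v w : nat) : fn :=
  Lt (Sum (K k) (Not (Or (Eq (Dig (V v.+2) (V 0)) (Dig (V w.+2) (V 0)))
    (joined_fn p.+2 0 v.+2 w.+2)))) (K 1).

Definition adj_fn (p v w : nat) : fn :=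
  Mul (valid_fn p v) (Mul (valid_fn p w)
    (Or (Lt (K 1) (ndiff_fn v w))
      (Mul (all_joined_fn p v w)
        (Or (Lt (K 0) (ndiff_fn v w))
          (Mul (Not (Eq (Dig (V v) (K k)) (Dig (V w) (K k))))
               (Eq (top_fn p v) (top_fn p w))))))).

Variables (n m h N D : nat) (M : nat -> nat).
Hypothesis q_gt0 : 0 < q.

Let G := [:: n; m; h; N; D].

(** Coordinates from [m] on are zero: the vectors are padded to [s] blocks of equal length [h]. *)
Definition input_coord (i j t : nat) : nat :=
  (t < m) * M (D + 2 + ((i * n + j) * m + t)).

Lemma globalE p c e : drop p e = G -> nth 0 e (p + c) = nth 0 G c.
Proof. by move=> <-; rewrite nth_drop. Qed.

Definition evalE := (eval_V, eval_K, eval_Plus, eval_Minus, eval_Peek, eval_Let,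
  eval_Mul, eval_Pow, eval_Lt, eval_Eq).

Lemma eval_Dig f g e : eval M (Dig f g) e = dig q (eval M f e) (eval M g e).
Proof.
rewrite /Dig eval_Mod // eval_Div ?eval_Pow // expn_gt0.
by rewrite /= q_gt0.
Qed.

Lemma eval_coord p i j t e : drop p e = G ->
  eval M (coord_fn p i j t) e = input_coord (nth 0 e i) (nth 0 e j) (nth 0 e t).
Proof. by move=> eG; rewrite /coord_fn !evalE !(globalE _ eG). Qed.

Lemma eval_rs_code p g i j t e : drop p e = G ->
  eval M (rs_code_fn p g i j t) e =
  rs_code q s h input_coord (nth 0 e g) (nth 0 e i) (nth 0 e j) (nth 0 e t).
Proof.
move=> eG; rewrite /rs_code_fn eval_Mod // eval_K; congr (_ %% _).
rewrite (eval_Sum (F := fun l => nth 0 e g ^ l *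
  input_coord (nth 0 e i) (nth 0 e j) (l * h + nth 0 e t))) // => l a _.
rewrite eval_Mul eval_Let eval_coord // !evalE.
by rewrite (@globalE p.+2 _ [:: l, a & e]).
Qed.

Lemma eval_label p v i t e : drop p e = G ->
  eval M (label_fn p v i t) e =
  dig q (nth 0 e v) (k + 1 + nth 0 e i * h + nth 0 e t).
Proof. by move=> eG; rewrite /label_fn eval_Dig !evalE (globalE _ eG). Qed.

Lemma sum_lt1 (I : finType) (P : pred I) :
  (\sum_i ~~ P i < 1) = [forall i, P i].
Proof.
rewrite ltnS leqn0 sum_nat_eq0.
by apply: eq_forallb => i; rewrite eqb0 negbK.
Qed.

Lemma eval_codes p i j v e : drop p e = G ->
  eval M (codes_fn p i j v) e =
  codes q k s h input_coord (nth 0 e i) (nth 0 e j) (nth 0 e v).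
Proof.
move=> eG; rewrite /codes_fn eval_Lt eval_K; congr (nat_of_bool _).
rewrite (eval_Sum (F := fun t => ~~ (dig q (nth 0 e v) (k + 1 + nth 0 e i * h + t) ==
  rs_code q s h input_coord (dig q (nth 0 e v) k) (nth 0 e i) (nth 0 e j) t))).
  by rewrite eval_V (globalE _ eG) /= sum_lt1.
move=> t a _; apply: eval_Not.
by rewrite eval_Eq eval_label // eval_Let eval_rs_code // eval_Dig.
Qed.

Lemma eval_valid p v e : drop p e = G ->
  eval M (valid_fn p v) e = valid q k h (nth 0 e v).
Proof.
move=> eG; rewrite /valid_fn eval_Lt eval_K; congr (nat_of_bool _).
rewrite (eval_Sum (F := fun t =>
  (\sum_(i < k) dig q (nth 0 e v) (k + 1 + i * h + t)) %% q)).
  by rewrite eval_V (globalE _ eG) /= ltnS leqn0 sum_nat_eq0.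
move=> t a _; rewrite eval_Mod // eval_K; congr (_ %% _).
rewrite (eval_Sum (F := fun i => dig q (nth 0 e v) (k + 1 + i * h + t))) //.
by move=> i b _; rewrite eval_label.
Qed.

Lemma eval_top p v e : drop p e = G ->
  eval M (top_fn p v) e = top q k h (nth 0 e v).
Proof.
move=> eG; have e0 : eval M (Pow (K q) (Plus (K (k + 1)) (Mul (K k) (V (p + 2))))) e
    = q ^ offset k h by rewrite !evalE (globalE _ eG).
by rewrite /top_fn eval_Div e0 // expn_gt0 q_gt0.
Qed.

Lemma sum_gt0 (I : finType) (P : pred I) : (0 < \sum_i P i) = [exists i, P i].
Proof.
rewrite lt0n sum_nat_eq0 negb_forall; apply: eq_existsb => i /=.
by rewrite eqb0 negbK.
Qed.

Lemma eval_joined p i v w e : drop p e = G ->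
  eval M (joined_fn p i v w) e =
  joined q k n s h input_coord (nth 0 e i) (nth 0 e v) (nth 0 e w).
Proof.
move=> eG; rewrite /joined_fn eval_Lt eval_K; congr (nat_of_bool _).
rewrite (eval_Sum (F := fun j => [&&
  dig q (nth 0 e v) (nth 0 e i) * j + top q k h (nth 0 e w) ==
    dig q (nth 0 e w) (nth 0 e i) * j + top q k h (nth 0 e v),
  codes q k s h input_coord (nth 0 e i) j (nth 0 e v)
  & codes q k s h input_coord (nth 0 e i) j (nth 0 e w)])).
  by rewrite eval_V (globalE _ eG) /= sum_gt0.
move=> j a _; rewrite 2!eval_Mul !eval_codes // eval_Eq 2!eval_Plus !eval_top //.
rewrite 2!eval_Mul !eval_Dig !eval_V /=.
by rewrite -!mulnb.
Qed.

Lemma eval_ndiff v w e :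
  eval M (ndiff_fn v w) e = ndiff q k (nth 0 e v) (nth 0 e w).
Proof.
rewrite /ndiff_fn (eval_Sum
  (F := fun i => dig q (nth 0 e v) i != dig q (nth 0 e w) i)) //.
by move=> i a _; apply: eval_Not; rewrite eval_Eq !eval_Dig.
Qed.

Lemma eval_Or f g e (b c : bool) : eval M f e = b -> eval M g e = c ->
  eval M (Or f g) e = b || c.
Proof. by move=> hf hg; rewrite /Or !evalE hf hg; case: b c {hf hg} => [] []. Qed.

Lemma eval_all_joined p v w e : drop p e = G ->
  eval M (all_joined_fn p v w) e =
  [forall i : 'I_k, (dig q (nth 0 e v) i == dig q (nth 0 e w) i) ||
     joined q k n s h input_coord i (nth 0 e v) (nth 0 e w)].
Proof.
move=> eG; rewrite /all_joined_fn eval_Lt eval_K; congr (nat_of_bool _).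
rewrite (eval_Sum (F := fun i => ~~ ((dig q (nth 0 e v) i == dig q (nth 0 e w) i) ||
     joined q k n s h input_coord i (nth 0 e v) (nth 0 e w)))); first by rewrite sum_lt1.
move=> i a _; apply: eval_Not; apply: eval_Or; last by rewrite eval_joined.
by rewrite eval_Eq !eval_Dig.
Qed.

Lemma eval_adj p v w e : drop p e = G ->
  eval M (adj_fn p v w) e =
  gap_adj q k n s h input_coord (nth 0 e v) (nth 0 e w).
Proof.
move=> eG; rewrite /adj_fn !eval_Mul !eval_valid // /gap_adj -!mulnb.
do 2!congr (_ * _); apply: eval_Or; first by rewrite eval_Lt eval_ndiff.
rewrite -mulnb eval_Mul eval_all_joined //; congr (_ * _).
apply: eval_Or; first by rewrite eval_Lt eval_ndiff.
rewrite -mulnb eval_Mul eval_Eq !eval_top //; congr (_ * _); apply: eval_Not.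
by rewrite eval_Eq !eval_Dig.
Qed.

Variable B : nat.
Hypotheses (B_gt0 : 0 < B) (qB : q <= B) (kB : k <= B) (sB : s <= B).
Hypotheses (nB : n <= B) (hB : h <= B) (oB : offset k h <= B).
Hypotheses (knB : k * n <= B) (kqB : k * q <= B) (sqB : s * (q ^ s * q) <= B).
Hypothesis coord_le : forall i j t, i < k -> j < n -> input_coord i j t <= q.

Lemma loops_Not f e : loops_le B M f e -> loops_le B M (Not f) e.
Proof. by []. Qed.

Lemma loops_Or f g e : loops_le B M f e -> loops_le B M g e ->
  loops_le B M (Or f g) e.
Proof. by []. Qed.

Lemma loops_Dig f g e : loops_le B M f e -> loops_le B M g e ->
  eval M f e <= B -> eval M g e <= B -> loops_le B M (Dig f g) e.
Proof.
move=> hf hg fB gB.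
have P0 : 0 < eval M (Pow (K q) g) e by rewrite eval_Pow eval_K expn_gt0 q_gt0.
apply: loops_Mod => //; first by apply: loops_Div => //; apply: loops_Pow.
by rewrite eval_Div // (leq_trans (leq_div _ _)).
Qed.

Lemma loops_coord p i j t e : drop p e = G -> nth 0 e i < k -> nth 0 e j < n ->
  loops_le B M (coord_fn p i j t) e.
Proof.
move=> eG ik jn; apply: loops_Mul => //; last first.
  by rewrite eval_Lt (leq_trans _ B_gt0) // leq_b1.
split=> //; split=> //; apply: loops_Mul => //.
  by split=> //; apply: loops_Mul => //; rewrite eval_V (leq_trans (ltnW ik)).
rewrite !evalE (globalE _ eG) /= (leq_trans _ knB) //.
by move: (nth 0 e i) (nth 0 e j) ik jn => a b; nia.
Qed.

Lemma loops_rs_code p g i j t e : drop p e = G -> nth 0 e g < q ->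
  nth 0 e i < k -> nth 0 e j < n -> loops_le B M (rs_code_fn p g i j t) e.
Proof.
move=> eG gq ik jn.
have powB l : l < s -> nth 0 e g ^ l <= q ^ s.
  move=> ls; apply: (@leq_trans (q ^ l)).
    by case: l {ls} => // l; rewrite leq_exp2r // ltnW.
  by rewrite leq_pexp2l // ltnW.
apply: loops_Mod => //.
  apply: loops_Sum => // l a ls; rewrite eval_K in ls.
  apply: loops_Mul.
  - apply: loops_Pow => //; rewrite ?eval_V /=.
      exact: leq_trans (ltnW gq) qB.
    exact: leq_trans (ltnW ls) sB.
  - split; last exact: loops_coord.
    by split=> //; apply: loops_Mul => //; exact: leq_trans (ltnW ls) sB.
  - rewrite eval_Pow !eval_V /= (leq_trans (powB l ls)) // (leq_trans _ sqB) //.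
    by rewrite -[leqLHS]mul1n leq_mul ?(leq_ltn_trans _ ls) // leq_pmulr.
(* Division loops on its dividend, so the unreduced sum must be at most [B]: it has [s] terms of
   size at most [q ^ s * q]. *)
rewrite (eval_Sum (F := fun l => nth 0 e g ^ l *
  input_coord (nth 0 e i) (nth 0 e j) (l * h + nth 0 e t))); last first.
  move=> l a _; rewrite eval_Mul eval_Let eval_coord // !evalE.
  by rewrite (@globalE p.+2 _ [:: l, a & e]).
rewrite eval_K (leq_trans _ sqB) // -[X in X * _]card_ord -sum_nat_const.
by apply: leq_sum => l _; rewrite leq_mul ?powB ?coord_le.
Qed.

Lemma loops_label p v i t e : drop p e = G -> nth 0 e v <= B ->
  nth 0 e i < k -> nth 0 e t < h -> loops_le B M (label_fn p v i t) e.
Proof.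
move=> eG vB ik th; apply: loops_Dig => //.
  split=> //; split=> //; apply: loops_Mul => //.
  by rewrite eval_V (leq_trans (ltnW ik)).
rewrite !evalE (globalE _ eG) /= (leq_trans _ oB) // /offset.
by move: (nth 0 e i) (nth 0 e t) ik th => a b; nia.
Qed.

Lemma loops_codes p i j v e : drop p e = G -> nth 0 e v <= B ->
  nth 0 e i < k -> nth 0 e j < n -> loops_le B M (codes_fn p i j v) e.
Proof.
move=> eG vB ik jn; apply: loops_Lt => //.
apply: loops_Sum => //; first by rewrite eval_V (globalE _ eG).
move=> t a; rewrite eval_V (globalE _ eG) => th.
apply: loops_Not; apply: loops_Eq; first exact: loops_label.
split; first by apply: loops_Dig.
by apply: loops_rs_code => //; rewrite [nth _ _ _]eval_Dig ltn_pmod.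
Qed.

Lemma loops_valid p v e : drop p e = G -> nth 0 e v <= B ->
  loops_le B M (valid_fn p v) e.
Proof.
move=> eG vB; apply: loops_Lt => //.
apply: loops_Sum => //; first by rewrite eval_V (globalE _ eG).
move=> t a; rewrite eval_V (globalE _ eG) => th.
apply: loops_Mod => //.
  by apply: loops_Sum => // i b ik; apply: loops_label.
rewrite (eval_Sum (F := fun i => dig q (nth 0 e v) (k + 1 + i * h + t))); last first.
  by move=> i b _; rewrite eval_label.
rewrite eval_K (leq_trans _ kqB) // -[X in X * _]card_ord -sum_nat_const.
by apply: leq_sum => l _; rewrite ltnW // ltn_pmod.
Qed.

Lemma loops_top p v e : drop p e = G -> nth 0 e v <= B ->
  loops_le B M (top_fn p v) e.
Proof.
move=> eG vB; apply: loops_Div => //; apply: loops_Pow => //.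
by rewrite !evalE (globalE _ eG).
Qed.

Lemma loops_joined p i v w e : drop p e = G -> nth 0 e v <= B ->
  nth 0 e w <= B -> nth 0 e i < k -> loops_le B M (joined_fn p i v w) e.
Proof.
move=> eG vB wB ik; apply: loops_Lt => //.
apply: loops_Sum => //; first by rewrite eval_V (globalE _ eG).
move=> j a; rewrite eval_V (globalE _ eG) => jn.
have iB : nth 0 e i <= B by apply: leq_trans kB; apply: ltnW.
have dB u : nth 0 e u <= B ->
    loops_le B M (Mul (Dig (V u.+2) (V i.+2)) (V 0)) [:: j, a & e].
  move=> uB; apply: loops_Mul => //; first exact: loops_Dig.
  by rewrite eval_Dig (leq_trans _ qB) // ltnW // ltn_pmod.
apply: loops_Mul.
- by apply: loops_Eq; (split; [exact: dB | exact: loops_top]).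
- apply: loops_Mul; try exact: loops_codes.
  by rewrite eval_codes // (leq_trans _ B_gt0) // leq_b1.
- by rewrite eval_Eq (leq_trans _ B_gt0) // leq_b1.
Qed.

Lemma loops_ndiff v w e : nth 0 e v <= B -> nth 0 e w <= B ->
  loops_le B M (ndiff_fn v w) e.
Proof.
move=> vB wB; apply: loops_Sum => // i a ik; rewrite eval_K in ik.
have iB : i <= B by apply: leq_trans kB; apply: ltnW.
by apply: loops_Not; apply: loops_Eq; apply: loops_Dig.
Qed.

Lemma loops_all_joined p v w e : drop p e = G -> nth 0 e v <= B ->
  nth 0 e w <= B -> loops_le B M (all_joined_fn p v w) e.
Proof.
move=> eG vB wB; apply: loops_Lt => //; apply: loops_Sum => // i a ik.
rewrite eval_K in ik; have iB : i <= B by apply: leq_trans kB; apply: ltnW.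
apply: loops_Not; apply: loops_Or; last exact: loops_joined.
by apply: loops_Eq; apply: loops_Dig.
Qed.

Lemma loops_adj p v w e : drop p e = G -> nth 0 e v <= B ->
  nth 0 e w <= B -> loops_le B M (adj_fn p v w) e.
Proof.
move=> eG vB wB.
have bB (b : bool) : b <= B by rewrite (leq_trans _ B_gt0) // leq_b1.
apply: loops_Mul; [exact: loops_valid | | by rewrite eval_valid].
apply: loops_Mul; [exact: loops_valid | | by rewrite eval_valid].
apply: loops_Or; first by apply: loops_Lt => //; apply: loops_ndiff.
apply: loops_Mul; [exact: loops_all_joined | | by rewrite eval_all_joined].
apply: loops_Or; first by apply: loops_Lt => //; apply: loops_ndiff.
apply: loops_Mul.
- by apply: loops_Not; apply: loops_Eq; apply: loops_Dig.
- by apply: loops_Eq; apply: loops_top.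
- rewrite (eval_Not (b := dig q (nth 0 e v) k == dig q (nth 0 e w) k)) //.
  by rewrite eval_Eq !eval_Dig.
Qed.

End Reduction.

(** During the main loop the memory agrees with the input only at the coordinates of genuine
    vectors; adjacency looks at no others. *)
Lemma gap_adj_ext q k n s h x y v w :
  (forall i j t, i < k -> j < n -> x i j t = y i j t) ->
  gap_adj q k n s h x v w = gap_adj q k n s h y v w.
Proof.
move=> xy.
have eC (i : 'I_k) (j : 'I_n) u : codes q k s h x i j u = codes q k s h y i j u.
  apply: eq_forallb => t; congr (_ == _ %% _).
  by apply: eq_bigr => l _; rewrite xy.
have eJ (i : 'I_k) : joined q k n s h x i v w = joined q k n s h y i v w.
  by apply: eq_existsb => j; rewrite !eC.
rewrite /gap_adj; congr [&& _, _ & _ || _ && _].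
by apply: eq_forallb => i; rewrite eJ.
Qed.

(** * The program for large instances *)

Section MainProgram.
Variables q k s : nat.

Definition height_fn : fn := Plus (Div (V 1) (K s)) (K 1).
Definition order_fn : fn :=
  Mul (Pow (K q) (Plus (K (k + 1)) (Mul (K k) (V 2))))
      (Plus (Mul (K (k * q)) (V 0)) (K 1)).
Definition length_fn : fn := Plus (K 2) (Mul (Mul (K k) (V 0)) (V 1)).
(** The address [N * N + L] of the copy of the input lies beyond the input itself and beyond the
    cells [0] to [N * N] of the output. *)
Definition base_fn : fn := Plus (Mul (V 3) (V 3)) length_fn.
(** Entry [j] of the matrix has row [j / N] and column [j mod N]; the two [Let]s and [j] itself put
    the globals at position 3. *)
Definition bit_fn : fn :=
  Let (Mod (V 0) (V 4)) (Let (Div (V 1) (V 5)) (adj_fn q k s 3 0 1)).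

Definition main_prog : prog :=
  Seq (compile (Peek (K 0)) [::] 4)
  (Seq (compile (Peek (K 1)) [::] 5)
  (Seq (compile height_fn [:: 4; 5] 6)
  (Seq (compile order_fn [:: 4; 5; 6] 7)
  (Seq (compile base_fn [:: 4; 5; 6; 7] 8)
  (Seq (store_loop length_fn (Plus (V 5) (V 0)) (Peek (V 0)) [:: 4; 5; 6; 7; 8] 9)
  (Seq (store_loop (Mul (V 3) (V 3)) (Plus (V 0) (K 1)) bit_fn [:: 4; 5; 6; 7; 8] 9)
  (Seq (Lit 9 false) (Write 9 7)))))))).

Definition main_size : nat :=
  fn_size height_fn + fn_size order_fn + fn_size base_fn + fn_size length_fn +
  fn_size (Mul (V 3) (V 3)) + fn_size bit_fn + 60.

Definition main_depth : nat :=
  fn_depth height_fn + fn_depth order_fn + fn_depth base_fn +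
  fn_depth length_fn + fn_depth (Mul (V 3) (V 3)) + fn_depth bit_fn + 2.

Variables (n m B : nat) (s0 : state).
Let h := m %/ s + 1.
Let N := gap_order q k n h.
Let L := 2 + k * n * m.
Let x i j t := (t < m) * ram s0 (2 + ((i * n + j) * m + t)).

Hypotheses (q_gt0 : 0 < q) (s_gt0 : 0 < s).
Hypotheses (n0 : ram s0 0 = n) (m0 : ram s0 1 = m).
Hypothesis inp_le : forall i, i < k * n * m -> ram s0 (2 + i) <= q.
Hypotheses (qB : q <= B) (kB : k <= B) (sB : s <= B).
Hypotheses (nB : n <= B) (hB : h <= B) (oB : offset k h <= B).
Hypotheses (mB : m <= B) (NB : N * N <= B) (LB : L <= B).
Hypotheses (knB : k * n <= B) (kqB : k * q <= B) (sqB : s * (q ^ s * q) <= B).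

Lemma main_progP : exists s' t, [/\ runs main_prog s0 t s',
  t <= main_size * B ^ main_depth, ram s' 0 = N
  & forall v w, v < N -> w < N ->
      ram s' (1 + v * N + w) = gap_adj q k n s h x v w].
Proof.
have B0 : 0 < B by apply: leq_trans qB.
have N0 : 0 < N by rewrite /N /gap_order muln_gt0 expn_gt0 q_gt0 addn1.
have NleB : N <= B by apply: leq_trans NB; rewrite leq_pmulr.
have qoB : q ^ offset k h <= B.
  by apply: leq_trans NleB; rewrite /N /gap_order leq_pmulr // addn1.
have [||s1 [t1 [r1 b1 m1 v1 o1]]] :=
  @compileP B B0 (Peek (K 0)) [::] 4 s0; [by [] | by [] | ].
have [||s2 [t2 [r2 b2 m2 v2 o2]]] :=
  @compileP B B0 (Peek (K 1)) [::] 5 s1; [by [] | by [] | ].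
have e2 : map (reg s2) [:: 4; 5] = [:: n; m].
  by rewrite /= v2 o2 // v1 /= m1 n0 m0.
have [||s3 [t3 [r3 b3 m3 v3 o3]]] :=
  @compileP B B0 height_fn [:: 4; 5] 6 s2; first by [].
  by rewrite e2; split=> //; apply: loops_Div.
have {}v3 : reg s3 6 = h by rewrite v3 e2 eval_Plus eval_Div.
have e3 : map (reg s3) [:: 4; 5; 6] = [:: n; m; h].
  by rewrite /= v3 !o3 //; case: e2 => -> ->.
have [||s4 [t4 [r4 b4 m4 v4 o4]]] :=
  @compileP B B0 order_fn [:: 4; 5; 6] 7 s3; first by [].
  rewrite e3; apply: loops_Mul.
  - by apply: loops_Pow => //; rewrite !evalE.
  - by split=> //; apply: loops_Mul.
  - by rewrite !evalE.
have {}v4 : reg s4 7 = N by rewrite v4 e3 !evalE.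
have e4 : map (reg s4) [:: 4; 5; 6; 7] = [:: n; m; h; N].
  by rewrite /= v4 !o4 //; case: e3 => -> -> ->.
have lL e : nth 0 e 0 = n -> forall M, loops_le B M length_fn e.
  move=> en M; split=> //; apply: loops_Mul => //.
  by rewrite !evalE en.
have [||s5 [t5 [r5 b5 m5 v5 o5]]] :=
  @compileP B B0 base_fn [:: 4; 5; 6; 7] 8 s4; first by [].
  by rewrite e4; split; [apply: loops_Mul | apply: lL].
pose D := N * N + L.
have {}v5 : reg s5 8 = D by rewrite v5 e4 eval_Plus !evalE.
pose G := [:: n; m; h; N; D].
have e5 : map (reg s5) [:: 4; 5; 6; 7; 8] = G.
  by rewrite /= v5 !o5 //; case: e4 => -> -> -> ->.
have M5 : ram s5 = ram s0 by rewrite m5 m4 m3 m2 m1.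
have cL M : eval M length_fn G = L by rewrite !evalE.
have [||||s6 [t6 [r6 b6 m6 o6]]] := @store_loopP B B0 length_fn (Plus (V 5) (V 0))
  (Peek (V 0)) [:: 4; 5; 6; 7; 8] 9 s5.
- by [].
- by rewrite e5; apply: lL.
- by rewrite e5 cL.
- by [].
rewrite e5 cL in m6.
have e6 : map (reg s6) [:: 4; 5; 6; 7; 8] = G by rewrite -e5 /= !o6.
have M6 i : i < L -> ram s6 (D + i) = ram s0 i.
  move=> iL; rewrite m6 (@store_mem_hit _ _ _ _ _ (addn D)) //; last exact: addnI.
  by rewrite eval_Peek /= store_mem_miss ?M5 // => j M' _ /=; rewrite neq_ltn /D; lia.
have cN M : eval M (Mul (V 3) (V 3)) G = N * N by rewrite !evalE.
pose MM j := store_mem (Plus (V 0) (K 1)) bit_fn G (ram s6) j.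
(* The copied input survives every round of the loop that writes the matrix. *)
have MMD j i : j <= N * N -> i < L -> MM j (D + i) = ram s0 i.
  move=> jN iL; rewrite -(M6 i iL) /MM store_mem_miss // => l M' lj /=.
  by rewrite neq_ltn /D; lia.
have cx j : j <= N * N -> forall i l t, i < k -> l < n ->
    input_coord n m D (MM j) i l t = x i l t.
  move=> jN i l t ik ln; rewrite /input_coord /x; case: ltnP => // tm; rewrite !mul1n.
  rewrite -addnA MMD // /L ltn_add2l.
  have : i * n + l < k * n by nia.
  by move: (i * n + l) => a; nia.
have cxB j : j <= N * N -> forall i l t, i < k -> l < n ->
    input_coord n m D (MM j) i l t <= q.
  move=> jN i l t ik ln; rewrite cx // /x; case: ltnP => // tm; rewrite mul1n.
  apply: inp_le.
  have : i * n + l < k * n by nia.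
  by move: (i * n + l) => a; nia.
have [||||s7 [t7 [r7 b7 m7 o7]]] := @store_loopP B B0 (Mul (V 3) (V 3))
  (Plus (V 0) (K 1)) bit_fn [:: 4; 5; 6; 7; 8] 9 s6.
- by [].
- by rewrite e6; apply: loops_Mul.
- by rewrite e6 cN.
- rewrite e6 cN => j jN M ->; split=> //; split.
    apply: loops_Mod => //; exact: leq_trans (ltnW jN) NB.
  split; first by apply: loops_Div => //; exact: leq_trans (ltnW jN) NB.
  apply: (@loops_adj _ _ _ n m h N D) => //.
  + by apply: cxB; apply: ltnW.
  + by rewrite [nth _ _ _]eval_Div //= ltnW // (leq_trans _ NleB) // ltn_divLR.
  + by rewrite [nth _ _ _]eval_Mod //= ltnW // (leq_trans _ NleB) // ltn_pmod.
rewrite e6 cN in m7.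
pose s8 := set_reg s7 9 0.
pose s9 := State (reg s8) (upd (ram s8) (reg s8 9) (reg s8 7)).
have e97 : reg s8 7 = N by rewrite /= upd_other // o7 //; case: e6.
have e99 : reg s8 9 = 0 by rewrite /= upd_same.
exists s9, (t1 + (t2 + (t3 + (t4 + (t5 + (t6 + (t7 + (1 + 1)))))))); split.
- do 7!(apply: runs_seq; first by eassumption).
  exact: (runs_seq (runs_lit 9 false s7) (runs_write 9 7 s8)).
- have le a d : d <= main_depth -> a * B ^ d <= a * B ^ main_depth.
    by move=> dd; rewrite leq_mul_exp.
  have P0 : 0 < B ^ main_depth by rewrite expn_gt0 B0.
  have {}b1 : t1 <= 3 * B ^ main_depth by apply: leq_trans b1 (le 3 _ _).
  have {}b2 : t2 <= 4 * B ^ main_depth by apply: leq_trans b2 (le 4 _ _).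
  have {}b3 : t3 <= fn_size height_fn * B ^ main_depth.
    by apply: leq_trans b3 (le _ _ _); rewrite /main_depth; lia.
  have {}b4 : t4 <= fn_size order_fn * B ^ main_depth.
    by apply: leq_trans b4 (le _ _ _); rewrite /main_depth; lia.
  have {}b5 : t5 <= fn_size base_fn * B ^ main_depth.
    by apply: leq_trans b5 (le _ _ _); rewrite /main_depth; lia.
  have {}b6 : t6 <= (fn_size length_fn + 5 + 3 + 10) * B ^ main_depth.
    apply: leq_trans b6 (le _ _ _); rewrite /main_depth.
    by rewrite [fn_depth (Plus (V _) _)]/= [fn_depth (Peek _)]/=; lia.
  have {}b7 : t7 <= (fn_size (Mul (V 3) (V 3)) + 6 + fn_size bit_fn + 10) *
      B ^ main_depth.
    apply: leq_trans b7 (le _ _ _); rewrite /main_depth.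
    by rewrite [fn_depth (Plus (V _) _)]/=; lia.
  move: b1 b2 b3 b4 b5 b6 b7 P0; rewrite /main_size.
  move: (B ^ main_depth) (fn_size height_fn) (fn_size order_fn) (fn_size base_fn).
  move: (fn_size length_fn) (fn_size (Mul _ _)) (fn_size bit_fn) => a b c P d e f.
  by clear; rewrite !mulnDl; lia.
- by rewrite -[LHS]/(upd (ram s8) (reg s8 9) (reg s8 7) 0) e99 upd_same.
- move=> v w vN wN.
  have jN : v * N + w < N * N by nia.
  rewrite [LHS]upd_other; last by rewrite e99 -addnA.
  have -> : 1 + v * N + w = v * N + w + 1 by rewrite addn1 add1n addSn.
  rewrite -[LHS]/(ram s7 _) m7.
  have -> := @store_mem_hit _ bit_fn G (ram s6) _ (addn^~ 1) _
    (fun j M' => erefl : eval M' (Plus (V 0) (K 1)) (j :: G) = j + 1) (@addIn 1) jN.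
  rewrite -/(MM _) !eval_Let (@eval_adj _ _ _ n m h N D) //.
  rewrite [nth _ _ 0]eval_Div // [nth _ _ 1]eval_Mod //=.
  rewrite divnMDl // (divn_small wN) addn0 modnMDl (modn_small wN).
  congr (nat_of_bool _); apply: gap_adj_ext => i j t ik jn.
  by apply: cx => //; apply: ltnW.
Qed.

End MainProgram.

(** * Input encoding and small instances *)

Lemma nth_flatten_const (T : Type) (x0 : T) (w : nat) (ss : seq (seq T)) a b :
  all (fun s => size s == w) ss -> a < size ss -> b < w ->
  nth x0 (flatten ss) (a * w + b) = nth x0 (nth [::] ss a) b.
Proof.
elim: ss a => // s ss IHs [|a] /= /andP[/eqP sw hs] aS bw.
  by rewrite mul0n add0n nth_cat sw bw.
by rewrite nth_cat sw mulSn -addnA ltnNge leq_addr /= addKn IHs.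
Qed.

Lemma size_flatten_const (T : Type) (w : nat) (ss : seq (seq T)) :
  all (fun s => size s == w) ss -> size (flatten ss) = size ss * w.
Proof.
elim: ss => //= s ss IHs /andP[/eqP sw hs].
by rewrite size_cat sw IHs // mulSn.
Qed.

Section Input.
Variables (q k n m : nat) (U : 'I_k -> n.-tuple 'rV['F_q]_m).
Hypothesis q_pr : prime q.

Definition input_cells : seq nat := drop 2 (vector_sum_input U).

Lemma size_input_cells : size input_cells = k * n * m.
Proof.
rewrite /input_cells /vector_sum_input /= drop0.
rewrite (@size_flatten_const _ (n * m)) 1?size_map ?size_enum_ord ?mulnA //.
apply/allP => _ /mapP[i _ ->]; rewrite (@size_flatten_const _ m).
  by rewrite size_map size_tuple.
by apply/allP => _ /mapP[u _ ->]; rewrite size_map size_enum_ord.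
Qed.

Lemma nth_input_cells (i : 'I_k) (j : 'I_n) (t : 'I_m) :
  nth 0 input_cells ((i * n + j) * m + t) = tnth (U i) j ord0 t.
Proof.
rewrite /input_cells /vector_sum_input /= drop0 mulnDl -mulnA -addnA.
have jtn : j * m + t < n * m by have := ltn_ord j; have := ltn_ord t; nia.
rewrite (@nth_flatten_const _ _ (n * m)) 1?size_map ?size_enum_ord //; last first.
  apply/allP => _ /mapP[i' _ ->]; rewrite (@size_flatten_const _ m).
    by rewrite size_map size_tuple.
  by apply/allP => _ /mapP[u _ ->]; rewrite size_map size_enum_ord.
rewrite (nth_map i) ?size_enum_ord // nth_ord_enum.
rewrite (@nth_flatten_const _ _ m) 1?size_map ?size_tuple //; last first.
  by apply/allP => _ /mapP[u _ ->]; rewrite size_map size_enum_ord.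
rewrite (nth_map (tnth (U i) j)) ?size_tuple // (nth_map t) ?size_enum_ord //.
by rewrite nth_ord_enum -tnth_nth.
Qed.

Lemma Fq_lt (a : 'F_q) : a < q.
Proof. by rewrite -[X in _ < X](Fp_cast q_pr) ltn_ord. Qed.

Lemma input_cells_lt : all (gtn q) input_cells.
Proof.
rewrite /input_cells /vector_sum_input /= drop0.
apply/allP => z /flattenP[_ /mapP[i _ ->]] /flattenP[_ /mapP[u _ ->]].
by move=> /mapP[t _ ->]; apply: Fq_lt.
Qed.

(** Solvability in terms of the list of cells alone, which is what a path in the decision tree
    knows. *)
Definition solvable_cells (n m : nat) (w : seq nat) : Prop :=
  exists j : 'I_k -> 'I_n, forall t, t < m ->
    q %| \sum_(i < k) nth 0 w ((i * n + j i) * m + t).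

Lemma has_vector_sumE : has_vector_sum U <-> solvable_cells n m input_cells.
Proof.
have sumE (j : 'I_k -> 'I_n) (t : 'I_m) :
    (\sum_(i < k) tnth (U i) (j i) ord0 t = 0)%R <->
    q %| \sum_(i < k) nth 0 input_cells ((i * n + j i) * m + t).
  rewrite (dvdn_pcharf (pchar_Fp q_pr)) natr_sum.
  have -> : (\sum_(i < k) (nth 0 input_cells ((i * n + j i) * m + t))%:R =
      \sum_(i < k) tnth (U i) (j i) ord0 t :> 'F_q)%R.
    by apply: eq_bigr => i _; rewrite nth_input_cells natr_Zp.
  by split=> [->|/eqP].
split=> [[u [uU u0]]|[j hj]].
  have uj i : exists j : 'I_n, u i == tnth (U i) j.
    by have /tnthP[j ->] := uU i; exists j.
  exists (fun i => xchoose (uj i)) => t tm.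
  apply: (proj1 (sumE _ (Ordinal tm))).
  have /matrixP/(_ ord0 (Ordinal tm)) := u0; rewrite summxE mxE => e0.
  rewrite -[RHS]e0.
  by apply: eq_bigr => i _; rewrite -(eqP (xchooseP (uj i))).
exists (fun i => tnth (U i) (j i)); split=> [i|]; first exact: mem_tnth.
apply/matrixP => a t; rewrite ord1 summxE mxE; apply/sumE; exact: hj.
Qed.

Lemma input2 i : nth 0 (vector_sum_input U) (2 + i) = nth 0 input_cells i.
Proof. by rewrite nth_drop. Qed.

End Input.

(** * Hard-wired outputs: a complete graph or the empty graph *)

Definition clique_bit_fn (P : nat) : fn := Not (Eq (Div (V 0) (K P)) (Mod (V 0) (K P))).

Definition clique_prog (P : nat) : prog :=
  Seq (store_loop (K (P * P)) (Plus (V 0) (K 1)) (clique_bit_fn P) [::] 4)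
  (Seq (compile (K P) [::] 4) (Seq (Lit 5 false) (Write 5 4))).

Definition empty_prog : prog := Seq (Lit 4 false) (Write 4 4).

Lemma empty_progP s : exists2 s', runs empty_prog s 2 s' & ram s' 0 = 0.
Proof.
eexists; first exact: (runs_seq (runs_lit 4 false s) (runs_write 4 4 _)).
by rewrite /= !upd_same.
Qed.

(** An absolute constant, serving as coefficient and as exponent: [P] enters the size of the bit
    function linearly and its depth not at all. The factor 2 comes from the loop bound [P * P]. *)
Definition clique_exp : nat :=
  60 + fn_size (clique_bit_fn 0) + 2 * (fn_depth (clique_bit_fn 0)).+2.

Lemma clique_progP (P : nat) (s : state) : 0 < P -> exists s' t,
  [/\ runs (clique_prog P) s t s', t <= clique_exp * P ^ clique_exp, ram s' 0 = P
    & forall v w, v < P -> w < P -> ram s' (1 + v * P + w) = (v != w)].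
Proof.
move=> P0; pose B := P * P; have B0 : 0 < B by rewrite muln_gt0 P0.
have eb M j : eval M (clique_bit_fn P) [:: j] = (j %/ P != j %% P).
  by apply: eval_Not; rewrite eval_Eq eval_Div // eval_Mod.
have [||||s1 [t1 [r1 b1 m1 o1]]] := @store_loopP B B0 (K B) (Plus (V 0) (K 1))
  (clique_bit_fn P) [::] 4 s.
- by [].
- by [].
- by [].
- move=> j jB M _; split=> //; split=> //.
  have jB' : j <= B by apply: ltnW.
  by split; [apply: loops_Div | apply: loops_Mod | ].
have [||s2 [t2 [r2 b2 m2 v2 o2]]] := @compileP B B0 (K P) [::] 4 s1; [by [] | by [] | ].
pose s3 := set_reg s2 5 0.
pose s4 := State (reg s3) (upd (ram s3) (reg s3 5) (reg s3 4)).
have e35 : reg s3 5 = 0 by rewrite /= upd_same.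
exists s4, (t1 + (t2 + (1 + 1))); split.
- apply: runs_seq r1 _; apply: runs_seq r2 _.
  exact: (runs_seq (runs_lit 5 false s2) (runs_write 5 4 s3)).
- pose d := fn_depth (clique_bit_fn 0); pose S0 := fn_size (clique_bit_fn 0).
  have Q0 : 0 < B ^ d.+1 by rewrite expn_gt0 B0.
  have szP : fn_size (clique_bit_fn P) = S0 + 2 * P by rewrite /S0 /=; lia.
  have {}b1 : t1 <= (B + S0 + 2 * P + 18) * B ^ d.+1.
    apply: leq_trans b1 _; rewrite szP leq_mul_exp //.
    by rewrite [fn_size (K _)]/= [fn_size (Plus _ _)]/=; lia.
  have {}b2 : t2 <= (P + 2) * B ^ d.+1.
    by apply: leq_trans b2 _; rewrite [fn_size _]/= leq_mul_exp.
  have PB : P <= B by rewrite /B leq_pmulr.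
  have hh : t1 + (t2 + (1 + 1)) <= (60 + S0) * B ^ d.+2.
    rewrite expnS; move: (B ^ d.+1) Q0 b1 b2 => X X0 h1 h2.
    apply: (@leq_trans ((B + S0 + 2 * P + 18 + (P + 2) + 2) * X)).
      by move: h1 h2; rewrite !mulnDl; lia.
    rewrite mulnA leq_mul2r; apply/orP; right.
    by clearbody S0; nia.
  apply: leq_trans hh _; rewrite /B mulnn -expnM leq_mul_exp //.
- by rewrite -[LHS]/(upd (ram s3) (reg s3 5) (reg s3 4) 0) e35 upd_same /= upd_other.
- move=> v w vP wP.
  rewrite [LHS]upd_other; last by rewrite e35 -addnA.
  have -> : 1 + v * P + w = v * P + w + 1 by rewrite addn1 add1n addSn.
  rewrite -[LHS]/(ram s2 _) m2 m1.
  have jB : v * P + w < B by rewrite /B; nia.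
  have -> := @store_mem_hit _ (clique_bit_fn P) [::] (ram s) _ (addn^~ 1) _
    (fun j M' => erefl : eval M' (Plus (V 0) (K 1)) [:: j] = j + 1) (@addIn 1) jB.
  by rewrite eb divnMDl // (divn_small wP) addn0 modnMDl (modn_small wP).
Qed.

(** * The reduction *)

(** At 44 it follows from [44 ^ 2 <= 2 ^ 11]. For the step, [(l+1)^2 / l^2 <= 9/8], and squaring
    twice, through [4/3], keeps the ratio of eighth powers below 2. *)
Lemma exp8_le_exp2 l : 44 <= l -> l ^ 8 <= 2 ^ l.
Proof.
elim: l => // l IHl; rewrite leq_eqVlt => /predU1P[<-|].
  by rewrite (expnM 44 2 4) (expnM 2 11 4) leq_exp2r.
rewrite ltnS => l44; rewrite [leqRHS]expnS (leq_trans _ (leq_mul (leqnn 2) (IHl l44))) //.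
rewrite (expnM _ 4 2) (expnM l 4 2) (expnM _ 2 2) (expnM l 2 2).
have h2 : 8 * l.+1 ^ 2 <= 9 * l ^ 2 by nia.
move: (l.+1 ^ 2) (l ^ 2) h2 => a b h2.
have h4 : 3 * a ^ 2 <= 4 * b ^ 2 by nia.
by move: (a ^ 2) (b ^ 2) h4 => c d h4; nia.
Qed.

(** The number [s] of blocks. The summand 1 keeps it positive when [k = 0]. *)
Definition code_length (k q : nat) : nat := k ^ 3 * (trunc_log 2 q).+1 + 1.

(** With [l] the truncated logarithm of [q], [k + 44 <= l] gives [k + s <= l ^ 4], and
    [l ^ 8 <= 2 ^ l <= q]. *)
Lemma code_length_le k q : 2 ^ (k + 44) <= q -> (k + code_length k q) ^ 2 <= q.
Proof.
move=> kq; have q0 : 0 < q by apply: leq_trans kq; rewrite expn_gt0.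
rewrite /code_length; set l := trunc_log 2 q.
have kl : k + 44 <= l by rewrite trunc_log_max.
have lq : 2 ^ l <= q by apply: trunc_logP.
apply: leq_trans lq; apply: leq_trans (exp8_le_exp2 _); last by lia.
rewrite (expnM l 4 2) leq_exp2r //.
have k3 : k ^ 3 <= l.-1 * l ^ 2.
  rewrite expnS leq_mul ?leq_exp2r //; lia.
have -> : l ^ 4 = l * (l * l ^ 2) by rewrite -!expnS.
move: (k ^ 3) k3 => a; have : l <= l ^ 2 by rewrite -mulnn; nia.
move: (l ^ 2) => b bl k3.
have : a * l <= l.-1 * b * l by rewrite leq_mul.
have : l = l.-1.+1 by lia.
nia.
Qed.

(** * Estimates with logarithms and real powers *)

Section Real.
Variable R : realType.
Local Open Scope ring_scope.

Lemma ln_nat_le (n : nat) : ln (n%:R : R) <= n%:R.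
Proof.
case: n => [|n]; first by rewrite ln0.
by apply: ltW; apply: ln_sublinear; rewrite ltr0n.
Qed.

Lemma dim_le (C k n m : nat) :
  m%:R <= C%:R * k%:R ^+ 2 * ln (n%:R : R) -> (m <= C * k ^ 2 * n)%N.
Proof.
move=> h; rewrite -(ler_nat R) (le_trans h) // natrM [(C * _)%N%:R]natrM natrX.
by rewrite ler_wpM2l ?ln_nat_le // mulr_ge0 ?ler0n ?exprn_ge0.
Qed.

(* [code_length] exceeds [k^3 ln q], and [m <= C k^2 ln n]. *)
Lemma labels_le (C k n m q : nat) : (0 < n)%N -> (1 < q)%N ->
  m%:R <= C%:R * k%:R ^+ 2 * ln (n%:R : R) ->
  (q ^ (k * (m %/ code_length k q)) <= n ^ C)%N.
Proof.
move=> n0 q1 h.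
have nR : (0 : R) < n%:R by rewrite ltr0n.
have qR : (0 : R) < q%:R by rewrite ltr0n ltnW.
have [->|k0] := posnP k; first by rewrite mul0n expn0 expn_gt0 n0.
rewrite -(ler_nat R) !natrX -ler_ln ?posrE ?exprn_gt0 // !lnXn //.
set l := trunc_log 2 q; set s := code_length k q.
(* Here [ln 2 <= 1] is used. *)
have lq : ln (q%:R : R) <= l.+1%:R.
  apply: (@le_trans _ _ (ln ((2 ^ l.+1)%N%:R : R))).
    rewrite ler_ln ?posrE ?ltr0n ?expn_gt0 //; last exact: ltnW.
    by rewrite ler_nat ltnW // trunc_log_ltn.
  rewrite natrX lnXn // -[leLHS]mulr_natl -[leRHS]mulr1 ler_wpM2l //.
  by have := @le_ln1Dx R 1; apply; rewrite (lt_trans _ ltr01) // ltrN10.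
have lq0 : 0 <= ln (q%:R : R) by rewrite ln_ge0 // ler1n ltnW.
have ln0' : 0 <= ln (n%:R : R) by rewrite ln_ge0 // ler1n.
(* After multiplying by [k ^ 3 * l.+1], which is at most [s], the quotient is bounded by [m], and
   [m <= C k^2 ln n] supplies the missing factor [k ^ 2]. *)
have : ((k * (m %/ s))%N%:R * (l.+1)%:R <= C%:R * ln n%:R :> R).
  have s0 : 0 < (k ^ 3 * l.+1)%N%:R :> R by rewrite ltr0n muln_gt0 expn_gt0 k0.
  rewrite -(ler_pM2r s0).
  have ms : (m %/ s * (k ^ 3 * l.+1) <= m)%N.
    apply: leq_trans (leq_trunc_div m s); rewrite leq_mul2l.
    by rewrite /s /code_length leq_addr orbT.
  have -> : (k * (m %/ s))%N%:R * l.+1%:R * (k ^ 3 * l.+1)%N%:R =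
      (k * l.+1)%N%:R * (m %/ s * (k ^ 3 * l.+1))%N%:R :> R.
    rewrite !natrM; ring.
  apply: (@le_trans _ _ ((k * l.+1)%N%:R * m%:R)).
    by rewrite ler_wpM2l ?ler0n ?ler_nat.
  apply: (@le_trans _ _ ((k * l.+1)%N%:R * (C%:R * k%:R ^+ 2 * ln n%:R))).
    by rewrite ler_wpM2l ?ler0n.
  rewrite natrM [(k ^ 3 * _)%N%:R]natrM natrX le_eqVlt; apply/orP; left.
  by apply/eqP; ring.
move=> h1; rewrite -[leLHS]mulr_natl -[leRHS]mulr_natl; apply: le_trans h1.
by rewrite ler_wpM2l ?ler0n.
Qed.

(** The worst case [f = 2 * k.+1] makes the right side [q ^ (k + 1/2)], that is [q ^ k * sqrt q]. *)
Lemma gap_powR (q k a f : nat) : (1 < q)%N -> (a ^ 2 <= q)%N ->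
  (2 * k.+1 <= f)%N ->
  (a * q ^ k)%N%:R <= (q ^ k.+1)%N%:R `^ (1 - f%:R^-1) :> R.
Proof.
move=> q1 aq kf.
have q1R : (1 : R) <= q%:R by rewrite ler1n ltnW.
have q0R : (0 : R) <= q%:R by rewrite ler0n.
apply: (@le_trans _ _ ((q ^ k.+1)%N%:R `^ (1 - (2 * k.+1)%N%:R^-1))); last first.
  apply: ler_powR; first by rewrite ler1n expn_gt0 ltnW.
  rewrite lerD2l lerN2 lef_pV2 ?posrE ?ltr0n ?ler_nat //.
  by apply: leq_trans kf.
rewrite natrX -powR_mulrn // -powRrM.
have -> : k.+1%:R * (1 - (2 * k.+1)%N%:R^-1) = k%:R + 2^-1 :> R.
  have k1 : k.+1%:R != 0 :> R by rewrite pnatr_eq0.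
  rewrite natrM -natr1; rewrite -natr1 in k1; by field.
rewrite powRD; last by rewrite (gt_eqF (lt_le_trans ltr01 q1R)) implybT.
rewrite powR_mulrn // powR12_sqrt // natrM natrX mulrC ler_wpM2l ?exprn_ge0 //.
by rewrite -[leLHS]ger0_norm // -sqrtr_sqr ler_sqrt // -natrX ler_nat.
Qed.

End Real.

Definition gap_graph (q k n s h : nat) (x : nat -> nat -> nat -> nat) : graph :=
  @Graph (gap_order q k n h) (fun u v => gap_adj q k n s h x u v)
    (fun u v => gap_adjC q k n s h x u v) (fun v => gap_adjxx q k n s h x v).

Lemma complete_adj_sym P : symmetric (fun u v : 'I_P => u != v).
Proof. by move=> u v; rewrite eq_sym. Qed.

Lemma complete_adj_irr P : irreflexive (fun u v : 'I_P => u != v).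
Proof. by move=> u; rewrite eqxx. Qed.

Definition complete_graph (P : nat) : graph :=
  Graph (@complete_adj_sym P) (@complete_adj_irr P).

(** Constants have depth 0, so the exponent of the running time is the same for all [k]. *)
Lemma main_depthE q k s : main_depth q k s = main_depth 0 0 0.
Proof. by []. Qed.

(** * Assembling the reduction *)

Section Program.
Variables C k q : nat.

Let s := code_length k q.
Let P := q ^ k.+1.

Definition order_const : nat := q ^ k * (k * q + 1).

(** Collects the coefficients of all bounds that [main_progP] puts on [B]; the power of [n] needed
    is [2 * C + 2], from the square of the number of vertices. *)
Definition loop_const : nat :=
  (P * order_const) ^ 2 + (q + k + s + k * q + s * (q ^ s * q) + C * k ^ 2 + 1 +
    (2 * k + 1 + C * k ^ 3) + (2 + C * k ^ 3)).

(** Factors such as [q ^ s] are not polynomial in [q ^ k.+1]. From this threshold on, a single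
    factor [n] absorbs them in the running time, and another absorbs [order_const] in the number of
    vertices. *)
Definition large_n : nat :=
  main_size q k s * loop_const ^ main_depth 0 0 0 + order_const + 1.

(** The case distinction is made when the program is formed, not during its run. *)
Definition leaf_prog (n m : nat) (w : seq nat) : prog :=
  if `[< solvable_cells q k n m w >] then clique_prog P else empty_prog.

(** For small [n] the table for [m] is long enough by [dim_le]. The main program fetches [n] and [m]
    from memory again. *)
Definition reduction : prog :=
  Seq (Lit 3 false)
    (read_switch large_n (fun n =>
       read_switch (C * k ^ 2 * large_n).+1 (fun m =>
         read_tree q (k * n * m) (leaf_prog n m)) empty_prog)
     (main_prog q k s)).

(** Depends on [C] only, as the constant must be chosen before [k]. *)
Definition time_exp : nat :=
  10 * C + clique_exp + 30 + (2 * C + 2) * main_depth 0 0 0.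

Hypothesis q_pr : prime q.

Let q_gt1 : 1 < q. Proof. exact: prime_gt1. Qed.
Let q_gt0 : 0 < q. Proof. exact: prime_gt0. Qed.
Let s_gt0 : 0 < s. Proof. by rewrite /s /code_length addn1. Qed.
Let P_gt0 : 0 < P. Proof. by rewrite expn_gt0 q_gt0. Qed.

Section Instance.
Variables (R : realType) (n m : nat) (U : 'I_k -> n.-tuple 'rV['F_q]_m).
Hypothesis mC : (m%:R <= C%:R * k%:R ^+ 2 * ln (n%:R : R))%R.

Let T c := P ^ c * (c * n ^ c + c).
Let mle : m <= C * k ^ 2 * n. Proof. exact: dim_le mC. Qed.

Definition good_run (t : nat) (s' : state) (G : graph) : Prop :=
  [/\ runs reduction (init_state (vector_sum_input U)) t s', t <= T time_exp,
      encodes_graph s' G,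
      nverts G <= P * (time_exp * n ^ time_exp + time_exp) &
      (has_vector_sum U ->
         exists S : {set 'I_(nverts G)}, clique S /\ #|S| = P) /\
      (~ has_vector_sum U ->
         forall S : {set 'I_(nverts G)}, clique S -> #|S| < (k + s) * q ^ k)].

Lemma small_run : n < large_n -> exists t s' G, good_run t s' G.
Proof.
move=> nl; pose s0 := init_state (vector_sum_input U).
pose s1 := set_reg s0 3 0.
have [s2 [m2 v2 h2]] := read_switchP large_n (fun n =>
       read_switch (C * k ^ 2 * large_n).+1 (fun m =>
         read_tree q (k * n * m) (leaf_prog n m)) empty_prog) (main_prog q k s) s1.
have e1 : ram s1 (reg s1 3) = n by [].
rewrite e1 nl in h2.
have e2 : reg s2 3 = 1 by rewrite v2.
have [s3 [m3 v3 h3]] := read_switchP (C * k ^ 2 * large_n).+1 (fun m =>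
         read_tree q (k * n * m) (leaf_prog n m)) empty_prog s2.
have e3 : ram s2 (reg s2 3) = m by rewrite e2 m2.
have ml : m < (C * k ^ 2 * large_n).+1.
  by rewrite ltnS (leq_trans mle) // leq_mul2l ltnW ?orbT.
rewrite e3 ml in h3.
have [||i iL|s4 [t4 [m4 b4 h4]]] :=
  @read_treeP q (k * n * m) (leaf_prog n m) s3 (input_cells U).
- exact: size_input_cells.
- exact: input_cells_lt.
- by rewrite v3 e2 m3 m2 -input2.
have run0 t s' : runs (leaf_prog n m (input_cells U)) s4 t s' ->
    runs reduction s0 (1 + (3 * n + 4 + (3 * m + 4 + (t4 + t)))) s'.
  move=> /h4/h3/h2 h; exact: (runs_seq (runs_lit 3 false s0) h).
have timeB t : t <= clique_exp * P ^ clique_exp + 2 ->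
    1 + (3 * n + 4 + (3 * m + 4 + (t4 + t))) <= T time_exp.
  move=> tB; rewrite /T.
  have cE : 10 * C + clique_exp + 30 <= time_exp by rewrite /time_exp leq_addr.
  move: time_exp cE => c cE.
  have X4 : P ^ 4 <= P ^ c by rewrite leq_pexp2l //; lia.
  have Xc : P ^ clique_exp <= P ^ c by rewrite leq_pexp2l //; lia.
  have Y2 : n ^ 2 <= n ^ c.
    by have [->|n_gt0] := posnP n; [rewrite exp0n | rewrite leq_pexp2l //; lia].
  have nn : n <= n ^ 2 by rewrite -mulnn; nia.
  have kP : k <= P by rewrite /P expnS (leq_trans (ltnW (ltn_expl k q_gt1))) // leq_pmull.
  have qP : q <= P by rewrite /P expnS leq_pmulr // expn_gt0 q_gt0.
  have mB : m <= C * (P ^ 4 * n ^ 2).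
    rewrite (leq_trans mle) // -mulnA leq_mul2l; apply/orP; right.
    rewrite leq_mul // (@leq_trans (P ^ 2)) ?leq_exp2r // leq_pexp2l //.
  (* The tree reads [k * n * m] symbols at cost [3 * q + 4 <= 7 * P] each, with
     [m <= C * P ^ 2 * n]. *)
  have tB4 : t4 <= 7 * (C * (P ^ 4 * n ^ 2)).
    apply: leq_trans b4 _.
    have -> : 7 * (C * (P ^ 4 * n ^ 2)) = P * n * (C * P ^ 2 * n) * (7 * P).
      by rewrite (expnD P 2 2) -!mulnn; ring.
    rewrite leq_mul //; last by move: qP q_gt0; lia.
    rewrite leq_mul // ?leq_mul // (leq_trans mle) // !leq_mul2r leq_mul2l.
    by rewrite leq_exp2r // kP !orbT.
  have XY : P ^ 4 * n ^ 2 <= P ^ c * n ^ c by rewrite leq_mul.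
  have CXY : C * (P ^ 4 * n ^ 2) <= C * (P ^ c * n ^ c) by rewrite leq_mul2l XY orbT.
  have X0 : 0 < P ^ c by rewrite expn_gt0 P_gt0.
  have YXY : n ^ c <= P ^ c * n ^ c by rewrite leq_pmull.
  have eXc : clique_exp * P ^ clique_exp <= clique_exp * P ^ c.
    by rewrite leq_mul2l Xc orbT.
  have cXY : (10 * C + 3) * (P ^ c * n ^ c) <= c * (P ^ c * n ^ c).
    by rewrite leq_mul2r; apply/orP; right; lia.
  have cX : (clique_exp + 11) * P ^ c <= c * P ^ c.
    by rewrite leq_mul2r; apply/orP; right; lia.
  move: cXY cX; rewrite mulnDr [P ^ c * (c * _)]mulnCA [P ^ c * c]mulnC.
  rewrite mulnDl -mulnA [(clique_exp + 11) * _]mulnDl.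
  move: mB tB4 CXY X0 YXY eXc Y2 nn tB.
  move: (P ^ 4 * n ^ 2) (P ^ c * n ^ c) (P ^ c) (n ^ c) (n ^ 2) (P ^ clique_exp).
  by clear; lia.
have vB : P <= P * (time_exp * n ^ time_exp + time_exp).
  by rewrite leq_pmulr // addn_gt0 /time_exp; apply/orP; right; lia.
move: run0; rewrite /leaf_prog; case: asboolP => hs run0.
  have [s5 [t5 [r5 b5 z5 a5]]] := clique_progP s4 P_gt0.
  exists (1 + (3 * n + 4 + (3 * m + 4 + (t4 + t5)))), s5, (complete_graph P).
  split=> //; first exact: run0.
  - by apply: timeB; lia.
  - by split=> // u v; rewrite a5.
  - split=> [_|/has_vector_sumE]; last by case.
    exists [set: 'I_P]; split; first by move=> u v.
    by rewrite cardsT card_ord.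
(* On a no-instance the empty graph is output; its only clique is empty and [(k + s) * q ^ k] is
   positive. *)
have [s5 r5 z5] := empty_progP s4.
exists (1 + (3 * n + 4 + (3 * m + 4 + (t4 + 2)))), s5, (complete_graph 0).
split=> //; first exact: run0.
- by apply: timeB; lia.
- by split=> // - [].
- split=> [/has_vector_sumE|_ S _]; first by move=> /(_ q_pr).
  by rewrite eq_card0 ?muln_gt0 ?expn_gt0 ?q_gt0 ?addn_gt0 ?s_gt0 ?orbT // => - [].
Qed.

Lemma large_run : large_n <= n -> exists t s' G, good_run t s' G.
Proof.
move=> nl; pose s0 := init_state (vector_sum_input U).
pose s1 := set_reg s0 3 0.
have n_gt0 : 0 < n by apply: leq_trans nl; rewrite /large_n addn1.
have [s2 [m2 v2 h2]] := read_switchP large_n (fun n =>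
       read_switch (C * k ^ 2 * large_n).+1 (fun m =>
         read_tree q (k * n * m) (leaf_prog n m)) empty_prog) (main_prog q k s) s1.
have e1 : ram s1 (reg s1 3) = n by [].
rewrite e1 ltnNge nl /= in h2.
pose h := m %/ s + 1; pose N := gap_order q k n h.
pose B := loop_const * n ^ (2 * C + 2).
(* The exponent [offset] splits into [k.+1], giving [P], then [k * (m %/ s)], bounded by
   [labels_le], and a remaining [k] from rounding up the block length. *)
have NB1 : N <= P * order_const * n ^ (C + 1).
  have -> : N = P * (q ^ (k * (m %/ s)) * q ^ k) * (k * q * n + 1).
    by rewrite /N /gap_order /offset /h [k * (_ + 1)]mulnDr muln1 [k + 1]addn1 2!expnD.
  have -> : P * order_const * n ^ (C + 1) = P * (n ^ C * q ^ k) * ((k * q + 1) * n).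
    by rewrite /order_const expnD expn1; ring.
  rewrite leq_mul // ?leq_mul2l ?leq_mul2r ?(labels_le n_gt0 q_gt1 mC) ?orbT //.
  by rewrite mulnDl mul1n leq_add2l.
have le_B a j : a <= loop_const -> j <= 2 -> a * n ^ j <= B.
  by move=> aB j2; rewrite leq_mul // leq_pexp2l //; lia.
have le_B0 a : a <= loop_const -> a <= B.
  by move=> aB; rewrite -[a]muln1; apply: (le_B a 0).
have le_B1 a : a <= loop_const -> a * n <= B by move=> aB; apply: (le_B a 1).
have le_B2 a : a <= loop_const -> a * (n * n) <= B.
  by move=> aB; rewrite mulnn; apply: (le_B a 2).
have [||||||||||||||| s3 [t3 [r3 b3 z3 a3]]] :=
  @main_progP q k s n m B s2 q_gt0 s_gt0.
- by rewrite m2.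
- by rewrite m2.
- move=> i iL; rewrite m2 -[ram _ _]/(nth 0 (vector_sum_input U) (2 + i)) input2.
  have /allP/(_ (nth 0 (input_cells U) i)) := input_cells_lt U q_pr.
  by move/(_ (mem_nth 0 _)) => lt; apply: ltnW; apply: lt; rewrite size_input_cells.
- by apply: le_B0; rewrite /loop_const; lia.
- by apply: le_B0; rewrite /loop_const; lia.
- by apply: le_B0; rewrite /loop_const; lia.
- by rewrite -[n]mul1n; apply: le_B1; rewrite /loop_const; lia.
- apply: leq_trans (le_B1 (C * k ^ 2 + 1) _); last by rewrite /loop_const; lia.
  by rewrite mulnDl mul1n leq_add // (leq_trans (leq_div _ _)).
- apply: leq_trans (le_B1 (2 * k + 1 + C * k ^ 3) _); last by rewrite /loop_const; lia.
  have hb : m %/ s + 1 <= C * k ^ 2 * n + 1.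
    by rewrite leq_add2r (leq_trans (leq_div _ _)).
  apply: (@leq_trans (k + 1 + k * (C * k ^ 2 * n + 1))).
    by rewrite /offset leq_add2l leq_mul2l hb orbT.
  rewrite expnS; move: (k ^ 2) => a; nia.
- apply: leq_trans mle _; apply: le_B1; rewrite /loop_const; lia.
- apply: (@leq_trans ((P * order_const * n ^ (C + 1)) * (P * order_const * n ^ (C + 1)))).
    exact: leq_mul.
  rewrite mulnn expnMn -expnM [(C + 1) * 2]mulnDl mul1n [C * 2]mulnC /B leq_mul2r.
  by rewrite /loop_const leq_addr orbT.
- apply: leq_trans (le_B2 (2 + C * k ^ 3) _); last by rewrite /loop_const; lia.
  rewrite mulnDl leq_add //; first by rewrite leq_pmulr // muln_gt0 n_gt0.
  apply: (@leq_trans (k * n * (C * k ^ 2 * n))); first by rewrite leq_mul2l mle orbT.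
  by rewrite [k ^ 3]expnS; apply: eq_leq; ring.
- by apply: le_B1; rewrite /loop_const; lia.
- by apply: le_B0; rewrite /loop_const; lia.
- by apply: le_B0; rewrite /loop_const; lia.
set x := (fun i j t : nat => _) in a3.
(* Since [m < s * h], all coordinates are covered, and those from [m] on are zero by padding. *)
have solE (j : 'I_k -> 'I_n) : solution q s h x j <-> forall t, t < m ->
    q %| \sum_(i < k) nth 0 (input_cells U) ((i * n + j i) * m + t).
  have xE t : t < m -> \sum_(i < k) x i (j i) t =
      \sum_(i < k) nth 0 (input_cells U) ((i * n + j i) * m + t).
    move=> tm; apply: eq_bigr => i _; rewrite /x tm mul1n m2.
    by rewrite -[ram _ _]/(nth 0 (vector_sum_input U) _) input2.
  split=> hj t th.
    rewrite -xE //; apply: hj; rewrite mulnC /h addn1.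
    exact: ltn_trans th (ltn_ceil _ _).
  have [tm|mt] := ltnP t m; first by rewrite xE ?hj.
  by rewrite big1 // => i _; rewrite /x ltnNge mt.
exists (1 + (3 * large_n + 3 + t3)), s3, (gap_graph q k n s h x); split.
- exact: (runs_seq (runs_lit 3 false s0) (h2 _ _ r3)).
- rewrite /T.
  (* The successor in the exponent is the factor [n] that absorbs [main_size] and the power of
     [loop_const]. *)
  have b3' : t3 <= n ^ ((2 * C + 2) * main_depth 0 0 0).+1.
    apply: leq_trans b3 _; rewrite main_depthE /B expnMn -expnM mulnA expnS.
    by rewrite leq_mul2r (leq_trans _ nl) ?orbT // /large_n -addnA leq_addr.
  have b3'' : t3 <= n ^ time_exp.
    by apply: leq_trans b3' _; rewrite leq_pexp2l // /time_exp; lia.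
  have nc : n <= n ^ time_exp.
    by rewrite -[X in X <= _]expn1 leq_pexp2l // /time_exp; lia.
  have c30 : 30 <= time_exp by rewrite /time_exp; lia.
  apply: (@leq_trans (time_exp * n ^ time_exp + time_exp)); last first.
    by rewrite leq_pmull // expn_gt0 P_gt0.
  have : 30 * n ^ time_exp <= time_exp * n ^ time_exp by rewrite leq_mul2r c30 orbT.
  by move: nl nc b3'' c30; clear; lia.
- by split=> //= u v; rewrite a3.
- apply: (leq_trans NB1); rewrite -mulnA leq_mul2l; apply/orP; right.
  (* One more factor [n] absorbs [order_const]. *)
  apply: (@leq_trans (n ^ (C + 2))).
    rewrite (_ : C + 2 = (C + 1).+1) ?expnS; last by lia.
    rewrite leq_mul2r (leq_trans _ nl) ?orbT //.
    by rewrite /large_n -addnA addnCA leq_addr.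
  apply: (@leq_trans (n ^ time_exp)); first by rewrite leq_pexp2l // /time_exp; lia.
  rewrite (@leq_trans (time_exp * n ^ time_exp)) ?leq_addr // leq_pmull //.
  by rewrite /time_exp; lia.
have h_gt0 : 0 < h by rewrite /h addn1.
split=> [/has_vector_sumE|no S cS].
  move=> /(_ q_pr)[j /solE sj].
  by have [S cS card_S] := gap_complete q_pr h_gt0 sj; exists S; rewrite card_S addn1.
apply: (@gap_sound _ _ _ _ _ x q_pr S h_gt0 s_gt0 cS) => j /solE sj; apply: no.
by apply/has_vector_sumE => //; exists j.
Qed.

Lemma run_ex : exists t s' G, good_run t s' G.
Proof. by case: (ltnP n large_n) => [/small_run|/large_run]. Qed.

End Instance.
End Program.

Local Open Scope ring_scope.

Theorem theorem4p1 (R : realType) (F : nat -> nat)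
    (F_incr : incr_unbounded F) (F_comp : computable F) :
  exists Lambda qhat : nat -> nat,
    [/\ computable Lambda, computable qhat, forall k, prime (qhat k),
        forall k, (0 < Lambda k)%N /\ (0 < F (Lambda k))%N
      & forall C : nat, exists c : nat, forall k : nat, exists p : prog,
        forall (n m : nat) (U : 'I_k -> n.-tuple 'rV['F_(qhat k)]_m),
        m%:R <= C%:R * k%:R ^+ 2 * ln (n%:R : R) ->
        (forall i, uniq (U i)) ->
        let T := (Lambda k ^ c * (c * n ^ c + c))%N in
        (forall r : T.-tuple bool, exists G : graph,
            outputs p (vector_sum_input U) r G /\
            (nverts G <= Lambda k * (c * n ^ c + c))%N) /\
        2 / 3 <= coin_prob (fun r : T.-tuple bool => exists G : graph,
          [/\ outputs p (vector_sum_input U) r G,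
              has_vector_sum U ->
                exists S : {set 'I_(nverts G)}, clique S /\ #|S| = Lambda k
            & ~ has_vector_sum U ->
                forall S : {set 'I_(nverts G)}, clique S ->
                  #|S|%:R < (Lambda k)%:R `^ (1 - (F (Lambda k))%:R^-1) :> R])].
Proof.
pose q := gap_prime F_incr.
have qP k : [/\ prime (q k), (2 * k.+1 <= F (q k ^ k.+1))%N & (2 ^ (k + 44) <= q k)%N].
  by apply/and3P; apply: gap_primeP.
exists (fun k => (q k ^ k.+1)%N), q; split.
- exact: computable_gap_prime_exp.
- exact: computable_gap_prime.
- by move=> k; have [] := qP k.
- move=> k; have [q_pr Fq _] := qP k; rewrite expn_gt0 prime_gt0 //; split=> //.
  exact: leq_trans Fq.
move=> C; exists (time_exp C) => k; exists (reduction C k (q k)) => n m U mC _ T.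
have [q_pr Fq kq] := qP k.
have [t [s' [G [ru tT enc nv [yes no]]]]] := run_ex q_pr U mC.
have out (r : T.-tuple bool) : outputs (reduction C k (q k)) (vector_sum_input U) r G.
  by exists t, s', r; split=> //; apply: ru.
split=> [r|]; first by exists G.
(* Every coin sequence leads to the same correct output, so the probability is 1. *)
rewrite /coin_prob (_ : #|_| = (2 ^ T)%N); last first.
  rewrite -card_bool -card_tuple; apply: eq_card => r; rewrite !inE.
  apply/asboolP; exists G; split=> // /no{}no S /no cS.
  (* The strict inequality comes from the clique bound, with [k + s] in the role of [a]. *)
  apply: lt_le_trans (gap_powR R (prime_gt1 q_pr) (code_length_le kq) Fq).
  by rewrite ltr_nat.
rewrite divff ?pnatr_eq0 ?expn_eq0 //.
Qed.
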